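(* Let $n\ge 2$. Let $\mathfrak{e}_{A_n}$ have generators $f_1,\dots,f_n$, and regard $\mathfrak{e}_{A_{n-1}}$ as the Lie algebra generated by $f_2,\dots,f_n$ subject to the type $A$ electrical relations among them. Let $\mathfrak{e}_{A_n}\oplus\mathfrak{e}_{A_{n-1}}$ be the direct sum Lie algebra with bracket $[(a,b),(c,d)]=([a,c],[b,d])$. Then there is a Lie algebra homomorphism $\phi:\mathfrak{e}_{B_n}\to \mathfrak{e}_{A_n}\oplus\mathfrak{e}_{A_{n-1}}$ with $\phi(e_1)=(f_1,0)$ and $\phi(e_k)=(f_k,f_k)$ for all $k\ge 2$, and $\phi$ is an isomorphism. Consequently \[\mathfrak{e}_{B_n}\cong \mathfrak{sp}_n\oplus\mathfrak{sp}_{n-1}.\]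
   Context: All Lie algebras are over $\mathbb{C}$. For a type $A$ diagram with consecutively labelled nodes, the electrical Lie algebra is generated by one generator $f_i$ per node subject to $[f_i,f_j]=0$ if $|i-j|\ge 2$ and $[f_i,[f_i,f_j]]=-2f_i$ if $|i-j|=1$; $\mathfrak{e}_{A_m}$ denotes the one with nodes $1,\dots,m$. The electrical Lie algebra $\mathfrak{e}_{B_n}$ is generated by $e_1,\dots,e_n$ subject to: $[e_i,e_j]=0$ if $|i-j|\ge 2$; $[e_i,[e_i,e_j]]=-2e_i$ if $|i-j|=1$ and $(i,j)\neq(2,1)$; and $[e_2,[e_2,[e_2,e_1]]]=0$. For even $m=2k$, $\mathfrak{sp}_m$ is the usual symplectic Lie algebra of $2k\times 2k$ matrices. For odd $m=2k+1$, $\mathfrak{sp}_m$ is the odd symplectic Lie algebra $\{X\in\mathfrak{sp}_{2k+2}: y_{k+1}\circ X=0\}$, where $\mathfrak{sp}_{2k+2}=\{X: X^T\Omega+\Omega X=0\}$ with $\Omega=\begin{pmatrix}0&I_{k+1}\\-I_{k+1}&0\end{pmatrix}$ and $y_{k+1}$ is the $(k+1)$-th coordinate functional on $\mathbb{C}^{2k+2}$ (i.e. the $(k+1)$-th row of $X$ vanishes). *)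

(* Defs.v *)
From HB Require Import structures.
From mathcomp Require Import all_boot all_order all_algebra ring.
From mathcomp Require Import boolp reals.
From mathcomp Require Export complex.

Set Implicit Arguments.
Unset Strict Implicit.
Unset Printing Implicit Defensive.

Import GRing.Theory.
Local Open Scope ring_scope.
Local Open Scope quotient_scope.

HB.mixin Record Lmodule_isLieAlgebra (K : fieldType) L of GRing.Lmodule K L := {
  lie_br : L -> L -> L;
  lie_br_linearl : forall z, linear (lie_br^~ z);
  lie_br_linearr : forall z, linear (lie_br z);
  lie_brxx : forall x, lie_br x x = 0;
  lie_jacobi : forall x y z,
    lie_br x (lie_br y z) + lie_br y (lie_br z x) + lie_br z (lie_br x y) = 0
}.

#[short(type="lieAlgType")]
HB.structure Definition LieAlgebra (K : fieldType) :=
  { L of GRing.Lmodule K L & Lmodule_isLieAlgebra K L }.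

Notation "[lie x , y ]" := (lie_br x y)
  (at level 0, x at level 200, y at level 200, format "[lie  x ,  y ]")
  : ring_scope.

Definition lie_morphism (K : fieldType) (L1 L2 : lieAlgType K)
    (phi : {linear L1 -> L2}) : Prop :=
  forall x y, phi [lie x, y] = [lie phi x, phi y].

Definition lie_isomorphism (K : fieldType) (L1 L2 : lieAlgType K)
    (phi : {linear L1 -> L2}) : Prop :=
  lie_morphism phi /\ bijective phi.

Definition lie_isomorphic (K : fieldType) (L1 L2 : lieAlgType K) : Prop :=
  exists phi : {linear L1 -> L2}, lie_isomorphism phi.

Section DirectSum.
Variables (K : fieldType) (L1 L2 : lieAlgType K).
Implicit Types x y : (L1 * L2)%type.

Definition prod_br x y : L1 * L2 := ([lie x.1, y.1], [lie x.2, y.2]).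

Fact prod_br_linearl z : linear (prod_br^~ z).
Proof. by move=> a x y; rewrite /prod_br /= !lie_br_linearl. Qed.

Fact prod_br_linearr z : linear (prod_br z).
Proof. by move=> a x y; rewrite /prod_br /= !lie_br_linearr. Qed.

Fact prod_brxx x : prod_br x x = 0.
Proof. by rewrite /prod_br !lie_brxx. Qed.

Fact prod_jacobi x y z :
  prod_br x (prod_br y z) + prod_br y (prod_br z x) + prod_br z (prod_br x y)
  = 0.
Proof. by congr (_, _); rewrite /= lie_jacobi. Qed.

HB.instance Definition _ := Lmodule_isLieAlgebra.Build K (L1 * L2)%type
  prod_br_linearl prod_br_linearr prod_brxx prod_jacobi.
End DirectSum.

Section MatrixLie.
Variables (K : fieldType) (n : nat).
Implicit Types A B C : 'M[K]_n.

Definition mx_br A B : 'M[K]_n := A *m B - B *m A.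

Fact mx_br_linearl C : linear (mx_br^~ C).
Proof.
move=> a A B; rewrite /mx_br mulmxDl mulmxDr -scalemxAl -scalemxAr scalerBr.
by rewrite opprD addrACA.
Qed.

Fact mx_br_linearr C : linear (mx_br C).
Proof.
move=> a A B; rewrite /mx_br mulmxDl mulmxDr -scalemxAl -scalemxAr scalerBr.
by rewrite opprD addrACA.
Qed.

Fact mx_brxx A : mx_br A A = 0.
Proof. exact: subrr. Qed.

Fact mx_jacobi A B C :
  mx_br A (mx_br B C) + mx_br B (mx_br C A) + mx_br C (mx_br A B) = 0.
Proof.
rewrite /mx_br !(mulmxBl, mulmxBr) !mulmxA !opprB.
by apply/matrixP=> i j; rewrite !mxE; ring.
Qed.

HB.instance Definition _ := Lmodule_isLieAlgebra.Build K 'M[K]_n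
  mx_br_linearl mx_br_linearr mx_brxx mx_jacobi.
End MatrixLie.

Record lieSub (K : fieldType) (L : lieAlgType K) := LieSub {
  lsub_pred :> {pred L};
  lsub_submod : submod_closed lsub_pred;
  lsub_br : {in lsub_pred &, forall x y, [lie x, y] \in lsub_pred}
}.

Section SubLie.
Variables (K : fieldType) (L : lieAlgType K) (S : lieSub L).

HB.instance Definition _ :=
  GRing.isSubmodClosed.Build K L (lsub_pred S)
    (GRing.submod_closed_semi (lsub_submod S)).

Record sub_lie := SubLie { sub_lie_val : L; _ : sub_lie_val \in lsub_pred S }.

HB.instance Definition _ := [isSub for sub_lie_val].
HB.instance Definition _ := [Choice of sub_lie by <:].
HB.instance Definition _ := [SubChoice_isSubLmodule of sub_lie by <:].
Implicit Types x y z : sub_lie.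

Definition sub_br x y : sub_lie := SubLie (lsub_br (valP x) (valP y)).

Fact sub_lie_valP a x y : val (a *: x + y) = a *: val x + val y.
Proof. by rewrite GRing.valD GRing.valZ. Qed.

Fact sub_br_linearl z : linear (sub_br^~ z).
Proof.
move=> a x y; apply: val_inj; rewrite sub_lie_valP !SubK.
exact: lie_br_linearl.
Qed.

Fact sub_br_linearr z : linear (sub_br z).
Proof.
move=> a x y; apply: val_inj; rewrite sub_lie_valP !SubK.
exact: lie_br_linearr.
Qed.

Fact sub_brxx x : sub_br x x = 0.
Proof. by apply: val_inj; rewrite GRing.val0 SubK lie_brxx. Qed.

Fact sub_jacobi x y z :
  sub_br x (sub_br y z) + sub_br y (sub_br z x) + sub_br z (sub_br x y) = 0.
Proof. by apply: val_inj; rewrite !GRing.valD GRing.val0 !SubK lie_jacobi. Qed.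

HB.instance Definition _ := Lmodule_isLieAlgebra.Build K sub_lie
  sub_br_linearl sub_br_linearr sub_brxx sub_jacobi.
End SubLie.

Section Symplectic.
Variables (K : fieldType) (k : nat).

Definition Omega : 'M[K]_(k + k) := block_mx 0 1%:M (- 1%:M) 0.

Definition symplectic_pred : {pred 'M[K]_(k + k)} :=
  fun X => X^T *m Omega + Omega *m X == 0.

Fact symplectic_submod : submod_closed symplectic_pred.
Proof.
split=> [|a X Y]; rewrite !unfold_in.
  by rewrite trmx0 mul0mx mulmx0 addr0.
move=> /eqP hX /eqP hY; rewrite linearP /= mulmxDl mulmxDr.
by rewrite -scalemxAl -scalemxAr addrACA -scalerDr hX hY scaler0 addr0.
Qed.

Fact symplectic_br :
  {in symplectic_pred &, forall X Y, [lie X, Y] \in symplectic_pred}.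
Proof.
move=> X Y; rewrite !unfold_in => /eqP hX /eqP hY; rewrite /lie_br /= /mx_br.
have {}hX : X^T *m Omega = - (Omega *m X) by apply/eqP; rewrite -addr_eq0 hX.
have {}hY : Y^T *m Omega = - (Omega *m Y) by apply/eqP; rewrite -addr_eq0 hY.
rewrite linearB /= !trmx_mul mulmxBl mulmxBr -!mulmxA hX hY !mulmxN !mulmxA.
by rewrite hX hY !mulNmx !opprK addrC subrKA subrr.
Qed.

Definition symplectic : lieSub 'M[K]_(k + k) :=
  LieSub symplectic_submod symplectic_br.
End Symplectic.

Section OddSymplectic.
Variables (K : fieldType) (k : nat).

(* Index of the coordinate y_(k+1), i.e., k when counting from 0. *)
Definition ylast : 'I_(k.+1 + k.+1) := lshift k.+1 ord_max.

Definition odd_symplectic_pred : {pred 'M[K]_(k.+1 + k.+1)} :=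
  fun X => (X \in symplectic K k.+1) && (row ylast X == 0).

Fact odd_symplecticE X :
  (X \in odd_symplectic_pred) = (X \in symplectic K k.+1) && (row ylast X == 0).
Proof. by []. Qed.

Fact odd_symplectic_submod : submod_closed odd_symplectic_pred.
Proof.
have [S0 SP] := lsub_submod (symplectic K k.+1).
split=> [|a X Y]; rewrite !odd_symplecticE; first by rewrite S0 row0 eqxx.
case/andP=> SX /eqP hX /andP[SY /eqP hY]; rewrite SP //=.
by rewrite linearP /= hX hY scaler0 addr0.
Qed.

Fact odd_symplectic_br :
  {in odd_symplectic_pred &, forall X Y, [lie X, Y] \in odd_symplectic_pred}.
Proof.
move=> X Y; rewrite !odd_symplecticE => /andP[SX /eqP hX] /andP[SY /eqP hY].
rewrite lsub_br //= /lie_br /= /mx_br linearB /= !row_mul hX hY !mul0mx.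
by rewrite subrr.
Qed.

Definition odd_symplectic : lieSub 'M[K]_(k.+1 + k.+1) :=
  LieSub odd_symplectic_submod odd_symplectic_br.
End OddSymplectic.

Definition sp (K : fieldType) (m : nat) : lieAlgType K :=
  if odd m then sub_lie (odd_symplectic K m./2) : lieAlgType K
  else sub_lie (symplectic K m./2) : lieAlgType K.

(* A Lie algebra given by generators and relations is realized as Lie words   *)
(* over the generators modulo the least congruence that contains the          *)
(* relations and satisfies the axioms of a Lie algebra.                       *)
Section Presentation.
Variables (K : fieldType) (I : Type).

Inductive lie_word :=
| WGen of I
| WZero
| WOpp of lie_word
| WAdd of lie_word & lie_word
| WScale of K & lie_word
| WBr of lie_word & lie_word.

HB.instance Definition _ := gen_eqMixin lie_word.
HB.instance Definition _ := gen_choiceMixin lie_word.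

Variable rel : lie_word -> lie_word -> Prop.

Inductive lie_cong : lie_word -> lie_word -> Prop :=
| cong_rel s t : rel s t -> lie_cong s t
| cong_refl s : lie_cong s s
| cong_sym s t : lie_cong s t -> lie_cong t s
| cong_trans s t u : lie_cong s t -> lie_cong t u -> lie_cong s u
| cong_opp s t : lie_cong s t -> lie_cong (WOpp s) (WOpp t)
| cong_add s s' t t' :
    lie_cong s s' -> lie_cong t t' -> lie_cong (WAdd s t) (WAdd s' t')
| cong_scale a s t : lie_cong s t -> lie_cong (WScale a s) (WScale a t)
| cong_br s s' t t' :
    lie_cong s s' -> lie_cong t t' -> lie_cong (WBr s t) (WBr s' t')
| cong_addA s t u : lie_cong (WAdd s (WAdd t u)) (WAdd (WAdd s t) u)
| cong_addC s t : lie_cong (WAdd s t) (WAdd t s)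
| cong_add0 s : lie_cong (WAdd WZero s) s
| cong_addN s : lie_cong (WAdd (WOpp s) s) WZero
| cong_scaleA a b s :
    lie_cong (WScale a (WScale b s)) (WScale (a * b) s)
| cong_scale1 s : lie_cong (WScale 1 s) s
| cong_scaleDr a s t :
    lie_cong (WScale a (WAdd s t)) (WAdd (WScale a s) (WScale a t))
| cong_scaleDl a b s :
    lie_cong (WScale (a + b) s) (WAdd (WScale a s) (WScale b s))
| cong_brDl s t u : lie_cong (WBr (WAdd s t) u) (WAdd (WBr s u) (WBr t u))
| cong_brDr s t u : lie_cong (WBr u (WAdd s t)) (WAdd (WBr u s) (WBr u t))
| cong_brZl a s t : lie_cong (WBr (WScale a s) t) (WScale a (WBr s t))
| cong_brZr a s t : lie_cong (WBr s (WScale a t)) (WScale a (WBr s t))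
| cong_brxx s : lie_cong (WBr s s) WZero
| cong_jacobi s t u :
    lie_cong
      (WAdd (WAdd (WBr s (WBr t u)) (WBr t (WBr u s))) (WBr u (WBr s t)))
      WZero.

Definition lie_congb (s t : lie_word) : bool := `[< lie_cong s t >].

Fact lie_congb_refl : reflexive lie_congb.
Proof. by move=> s; apply/asboolP/cong_refl. Qed.

Fact lie_congb_sym : symmetric lie_congb.
Proof. by move=> s t; apply/asboolP/asboolP => /cong_sym. Qed.

Fact lie_congb_trans : transitive lie_congb.
Proof.
move=> t s u /asboolP st /asboolP tu; apply/asboolP; exact: cong_trans st tu.
Qed.

Canonical lie_cong_equiv :=
  EquivRel lie_congb lie_congb_refl lie_congb_sym lie_congb_trans.

Definition lie_pres := {eq_quot lie_congb}.
HB.instance Definition _ := Choice.on lie_pres.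
HB.instance Definition _ := EqQuotient.on lie_pres.

Definition pclass (s : lie_word) : lie_pres := \pi s.

Fact pclassP s t : pclass s = pclass t <-> lie_cong s t.
Proof. by split=> [/eqmodP/asboolP | st]; last exact/eqmodP/asboolP. Qed.

Fact pclass_repr x : pclass (repr x) = x.
Proof. exact: reprK. Qed.

Fact repr_pclass s : lie_cong (repr (pclass s)) s.
Proof. exact/pclassP/pclass_repr. Qed.

Fact pclass_ind (P : lie_pres -> Prop) : (forall s, P (pclass s)) -> forall x, P x.
Proof. by move=> h x; rewrite -(pclass_repr x). Qed.

Definition lie_gen (i : I) : lie_pres := pclass (WGen i).
Definition pzero : lie_pres := pclass WZero.
Definition popp (x : lie_pres) : lie_pres := pclass (WOpp (repr x)).
Definition padd (x y : lie_pres) : lie_pres := pclass (WAdd (repr x) (repr y)).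
Definition pscale (a : K) (x : lie_pres) : lie_pres :=
  pclass (WScale a (repr x)).
Definition pbr (x y : lie_pres) : lie_pres := pclass (WBr (repr x) (repr y)).

Fact poppE s : popp (pclass s) = pclass (WOpp s).
Proof. exact/pclassP/cong_opp/repr_pclass. Qed.

Fact paddE s t : padd (pclass s) (pclass t) = pclass (WAdd s t).
Proof. by apply/pclassP/cong_add; apply: repr_pclass. Qed.

Fact pscaleE a s : pscale a (pclass s) = pclass (WScale a s).
Proof. exact/pclassP/cong_scale/repr_pclass. Qed.

Fact pbrE s t : pbr (pclass s) (pclass t) = pclass (WBr s t).
Proof. by apply/pclassP/cong_br; apply: repr_pclass. Qed.

Let pE := (poppE, paddE, pscaleE, pbrE).

Fact paddA : associative padd.
Proof.
elim/pclass_ind=> s; elim/pclass_ind=> t; elim/pclass_ind=> u.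
by rewrite !pE; apply/pclassP/cong_addA.
Qed.

Fact paddC : commutative padd.
Proof.
elim/pclass_ind=> s; elim/pclass_ind=> t.
by rewrite !pE; apply/pclassP/cong_addC.
Qed.

Fact padd0 : left_id pzero padd.
Proof. by elim/pclass_ind=> s; rewrite !pE; apply/pclassP/cong_add0. Qed.

Fact paddN : left_inverse pzero popp padd.
Proof. by elim/pclass_ind=> s; rewrite !pE; apply/pclassP/cong_addN. Qed.

HB.instance Definition _ :=
  GRing.isZmodule.Build lie_pres paddA paddC padd0 paddN.

Fact pscaleA a b x : pscale a (pscale b x) = pscale (a * b) x.
Proof. by elim/pclass_ind: x => s; rewrite !pE; apply/pclassP/cong_scaleA. Qed.

Fact pscale1 : left_id 1 pscale.
Proof. by elim/pclass_ind=> s; rewrite !pE; apply/pclassP/cong_scale1. Qed.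

Fact pscaleDr : right_distributive pscale +%R.
Proof.
move=> a; elim/pclass_ind=> s; elim/pclass_ind=> t.
by rewrite /GRing.add /= !pE; apply/pclassP/cong_scaleDr.
Qed.

Fact pscaleDl x : {morph pscale^~ x : a b / a + b}.
Proof.
move=> a b; elim/pclass_ind: x => s.
by rewrite [RHS]/GRing.add /= !pE; apply/pclassP/cong_scaleDl.
Qed.

HB.instance Definition _ := GRing.Zmodule_isLmodule.Build K lie_pres
  pscaleA pscale1 pscaleDr pscaleDl.

Fact pbr_linearl z : linear (pbr^~ z).
Proof.
move=> a; elim/pclass_ind: z => u; elim/pclass_ind=> s; elim/pclass_ind=> t.
rewrite /GRing.add /GRing.scale /= !pE; apply/pclassP.
apply: cong_trans (cong_brDl _ _ _) _; apply: cong_add (cong_refl _).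
exact: cong_brZl.
Qed.

Fact pbr_linearr z : linear (pbr z).
Proof.
move=> a; elim/pclass_ind: z => u; elim/pclass_ind=> s; elim/pclass_ind=> t.
rewrite /GRing.add /GRing.scale /= !pE; apply/pclassP.
apply: cong_trans (cong_brDr _ _ _) _; apply: cong_add (cong_refl _).
exact: cong_brZr.
Qed.

Fact pbrxx x : pbr x x = 0.
Proof. by elim/pclass_ind: x => s; rewrite !pE; apply/pclassP/cong_brxx. Qed.

Fact pbr_jacobi x y z :
  pbr x (pbr y z) + pbr y (pbr z x) + pbr z (pbr x y) = 0.
Proof.
elim/pclass_ind: x => s; elim/pclass_ind: y => t; elim/pclass_ind: z => u.
by rewrite /GRing.add /= !pE; apply/pclassP/cong_jacobi.
Qed.

HB.instance Definition _ := Lmodule_isLieAlgebra.Build K lie_pres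
  pbr_linearl pbr_linearr pbrxx pbr_jacobi.

Section Universal.
Variables (L : lieAlgType K) (g : I -> L).

Fixpoint word_eval (s : lie_word) : L :=
  match s with
  | WGen i => g i
  | WZero => 0
  | WOpp t => - word_eval t
  | WAdd t u => word_eval t + word_eval u
  | WScale a t => a *: word_eval t
  | WBr t u => [lie word_eval t, word_eval u]
  end.

Lemma lie_pres_univ :
  (forall s t, rel s t -> word_eval s = word_eval t) ->
  exists phi : {linear lie_pres -> L},
    lie_morphism phi /\ forall i, phi (lie_gen i) = g i.
Proof.
move=> hg; have brDl (x y z : L) : [lie x + y, z] = [lie x, z] + [lie y, z].
  by have /= := lie_br_linearl z 1 x y; rewrite !scale1r.
have brDr (x y z : L) : [lie z, x + y] = [lie z, x] + [lie z, y].
  by have /= := lie_br_linearr z 1 x y; rewrite !scale1r.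
have br0l (z : L) : [lie 0, z] = 0 by apply: (addIr [lie 0, z]); rewrite -brDl !add0r.
have br0r (z : L) : [lie z, 0] = 0 by apply: (addIr [lie z, 0]); rewrite -brDr !add0r.
have brZl a (x z : L) : [lie a *: x, z] = a *: [lie x, z].
  by have /= := lie_br_linearl z a x 0; rewrite !addr0 br0l addr0.
have brZr a (x z : L) : [lie z, a *: x] = a *: [lie z, x].
  by have /= := lie_br_linearr z a x 0; rewrite !addr0 br0r addr0.
have ev s t : lie_cong s t -> word_eval s = word_eval t.
  elim=> {s t} //=; try by move=> *; congruence.
  - by move=> s t u; rewrite addrA.
  - by move=> s t; exact: addrC.
  - by move=> s; rewrite add0r.
  - by move=> s; rewrite addNr.
  - by move=> a b s; rewrite scalerA.
  - by move=> s; rewrite scale1r.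
  - by move=> a s t; rewrite scalerDr.
  - by move=> a b s; rewrite scalerDl.
  - by move=> s; rewrite lie_brxx.
  - by move=> s t u; rewrite lie_jacobi.
pose f (x : lie_pres) := word_eval (repr x).
have fE s : f (pclass s) = word_eval s by apply/ev/repr_pclass.
have f_lin : linear f.
  move=> a; elim/pclass_ind=> s; elim/pclass_ind=> t.
  by rewrite {1}/GRing.add {1}/GRing.scale /= !pE !fE.
pose fM := GRing.isLinear.Build K lie_pres L *:%R f f_lin.
pose phi : {linear lie_pres -> L} := HB.pack f fM.
exists phi; split=> [|i]; last exact: fE.
elim/pclass_ind=> s; elim/pclass_ind=> t.
by rewrite /phi /= {1}/lie_br /= !pE !fE.
Qed.
End Universal.
End Presentation.

Arguments WZero {K I}.

Definition node (lo hi : nat) := {k : nat | (lo <= k <= hi)%N}.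

Section Electrical.
Variable K : fieldType.

(* `|val i - val j| is the integer distance, not a truncated difference. *)
Inductive eA_rel lo hi :
  lie_word K (node lo hi) -> lie_word K (node lo hi) -> Prop :=
| eA_comm (i j : node lo hi) : (2 <= `|val i - val j|)%N ->
    eA_rel (WBr (WGen K i) (WGen K j)) WZero
| eA_serre (i j : node lo hi) : `|val i - val j|%N = 1%N ->
    eA_rel (WBr (WGen K i) (WBr (WGen K i) (WGen K j)))
           (WScale (- 2%:R) (WGen K i)).

Definition eA_nodes lo hi : lieAlgType K := lie_pres (@eA_rel lo hi).

Definition eA_gen lo hi k (hk : (lo <= k <= hi)%N) : eA_nodes lo hi :=
  lie_gen (@eA_rel lo hi) (exist _ k hk).

Inductive eB_rel n : lie_word K (node 1 n) -> lie_word K (node 1 n) -> Prop :=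
| eB_comm (i j : node 1 n) : (2 <= `|val i - val j|)%N ->
    eB_rel (WBr (WGen K i) (WGen K j)) WZero
| eB_serre (i j : node 1 n) : `|val i - val j|%N = 1%N ->
    (val i, val j) <> (2, 1)%N ->
    eB_rel (WBr (WGen K i) (WBr (WGen K i) (WGen K j)))
           (WScale (- 2%:R) (WGen K i))
| eB_serre21 (i j : node 1 n) : val i = 2%N -> val j = 1%N ->
    eB_rel (WBr (WGen K i) (WBr (WGen K i) (WBr (WGen K i) (WGen K j)))) WZero.

Definition eB n : lieAlgType K := lie_pres (@eB_rel n).

Definition eB_gen n k (hk : (1 <= k <= n)%N) : eB n :=
  lie_gen (@eB_rel n) (exist _ k hk).
End Electrical.

(* Main.v *)
(** Nodes are numbered from 0 in the proof. Let V have basis u_0, ..., u_(n-1)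
    and let e_k act on V by e_k u_l = u_k if |k - l| = 1 and e_k u_l = 0
    otherwise. In a Lie algebra generated by elements e_k satisfying the
    type B relations, the ideal generated by e_0 is a quotient of Sym^2 V, with
    e_0 the image of u_0^2: this follows from the relations by induction on n,
    since e_1^2 acting on u_0^2 gives 2 u_1^2, which plays the role of u_0^2 for
    the nodes 1, ..., n-1.
      The type A relations imply the type B ones, and in e_(A_n) the ideal of e_0
    is everything. As sp_n has a basis indexed by pairs i <= j with the same action
    (the matrices p_i p_j^T Omega + p_j p_i^T Omega for a chain of vectors p_i,
    consecutive ones having symplectic product 1 up to sign), e_(A_n) = sp_n.
      In e_(B_n) the nodes 1, ..., n-1 span a copy of e_(A_(n-1)) complementary to
    the ideal of e_0, and phi maps that ideal isomorphically onto e_(A_n) + 0;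
    hence phi is bijective. *)

From HB Require Import structures.
Require Import Defs.
From mathcomp Require Import all_boot all_order all_algebra.
From mathcomp Require Import boolp reals complex.
From mathcomp Require Import ring zify.

Set Implicit Arguments.
Unset Strict Implicit.
Unset Printing Implicit Defensive.
Import Order.TTheory GRing.Theory Num.Theory.
Local Open Scope ring_scope.

(** * Adjacent nodes and cancellation of integer multiples *)

Definition adj (k i : nat) : bool := (k == i.+1) || (i == k.+1).

Lemma mulrn_inj (K : numFieldType) (M : lmodType K) n (x y : M) :
  x *+ n.+1 = y *+ n.+1 -> x = y.
Proof.
rewrite -!scaler_nat => h; apply: (scalerI (a := n.+1%:R : K)) => //.
by rewrite pnatr_eq0.
Qed.

(** The hypothesis is y = 4y - 6z, so 3y = 6z, and 3 cancels. It closes the elimination in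
    [corner_vector_step]. *)
Lemma twice_of_affine (K : numFieldType) (M : lmodType K) (y z : M) :
  y = ((y - z) *+ 2 - z) *+ 2 -> y = z *+ 2.
Proof.
move=> hyz; apply: (@mulrn_inj _ _ 2); apply: (@addIr _ (y - z *+ 6)).
rewrite [RHS]addrC -mulrnA subrK.
transitivity (((y - z) *+ 2 - z) *+ 2); last by [].
by rewrite addrA -mulrSr !mulrnBl -!mulrnA -[RHS]addrA -opprD -mulrnDr.
Qed.

(** * The quotient of Sym^2 V generated by a corner vector *)

Section Chain.
Variables (K : numFieldType) (M : lmodType K).
Implicit Types (n : nat) (E : nat -> {linear M -> M}) (v x : M).

(* The relations between nodes 0 and 1 are left out: corner_vector says what is
   needed of them. *)
Definition electrical_ops n E :=
  (forall i j x, (i.+1 < j < n)%N -> E i (E j x) = E j (E i x)) /\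
  (forall i j x, (0 < i < n)%N -> (0 < j < n)%N -> adj i j ->
     E i (E i (E j x)) + E j (E i (E i x)) = (E i (E j (E i x)) - E i x) *+ 2).

(* What the relations say about v = e_0 in the adjoint representation. *)
Definition corner_vector n E v :=
  [/\ E 0%N v = 0,
      forall k, (1 < k < n)%N -> E k v = 0
    & (1 < n)%N -> [/\ E 0%N (E 1%N v) = v *+ 2,
        E 0%N (E 1%N (E 1%N v)) = E 1%N v *+ 2
      & E 1%N (E 1%N (E 1%N v)) = 0]].

(* W i j stands for 2 u_i u_j in Sym^2 V. *)
Definition square_family n E (W : nat -> nat -> M) :=
  (forall i j, W i j = W j i) /\
  (forall k i j, (k < n)%N -> (i < n)%N -> (j < n)%N ->
     E k (W i j) = W k j *+ adj k i + W i k *+ adj k j).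

Lemma electrical_ops_behead n E :
  electrical_ops n.+1 E -> electrical_ops n (fun k => E k.+1).
Proof.
case=> hc hs; split=> [i j x ij|i j x ib jb ij]; first by apply: hc; lia.
by apply: hs; move: ij; rewrite /adj; lia.
Qed.

Lemma corner_vector_scale n E v a : corner_vector n E v -> corner_vector n E (a *: v).
Proof.
case=> h0 hk h1; split=> [|k kn|/h1 [h2 h3 h4]].
- by rewrite linearZ /= h0 scaler0.
- by rewrite linearZ /= hk ?scaler0.
- by split; rewrite !linearZ /= ?h2 ?h3 ?h4 ?scalerMnr ?linear0 ?scaler0.
Qed.

(** With the next two lemmas this leads from [W 0 0] to every [W i j]: along the row from [W i i],
    and from [W i i.+1] to the next diagonal entry. Inductions over a square family follow these
    paths. *)
Lemma square_raise n E W i j : square_family n E W ->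
  (i < j)%N -> (j.+1 < n)%N -> E j.+1 (W i j) = W i j.+1.
Proof.
move=> [_ Wa] ij jn; rewrite (Wa j.+1); try lia.
rewrite (_ : adj j.+1 i = false); last by rewrite /adj; lia.
by rewrite (_ : adj j.+1 j = true) ?add0r // /adj; lia.
Qed.

Lemma square_raise_diag n E W i : square_family n E W ->
  (i.+1 < n)%N -> E i.+1 (W i i) = W i i.+1 *+ 2.
Proof.
move=> [Ws Wa] ij; rewrite (Wa i.+1); try lia.
by rewrite (_ : adj i.+1 i = true) ?(Ws i.+1 i) // /adj; lia.
Qed.

Lemma square_diag n E W i : square_family n E W ->
  (i.+1 < n)%N -> E i.+1 (W i i.+1) = W i.+1 i.+1.
Proof.
move=> [Ws Wa] ij; rewrite (Wa i.+1); try lia.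
rewrite (_ : adj i.+1 i.+1 = false); last by rewrite /adj; lia.
by rewrite (_ : adj i.+1 i = true) ?addr0 // /adj; lia.
Qed.

(** * Induction step: adjoining node 0 *)

Section Step.
Variables (n : nat) (E : nat -> {linear M -> M}) (v : M).
Hypotheses (hE : electrical_ops n.+1 E) (hv : corner_vector n.+1 E v).

(** For v = u_0^2 the new corner is 2 u_1^2. Its relations with node 2 follow from the two Serre
    relations between E_1 and E_2, given E_2 v = 0 and E_1^3 v = 0. *)
Lemma corner_vector_step : (0 < n)%N ->
  corner_vector n (fun k => E k.+1) (E 1%N (E 1%N v)).
Proof.
move=> n0; have [hc hs] := hE; have [h0 hk /(_ n0) [h1 h2 h3]] := hv.
split=> // [k kn|n1].
  by rewrite -(hc 1%N) ?ltnS // -(hc 1%N) ?ltnS // hk ?linear0 //; lia.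
have s12 x : E 1%N (E 1%N (E 2%N x)) + E 2%N (E 1%N (E 1%N x))
    = (E 1%N (E 2%N (E 1%N x)) - E 1%N x) *+ 2 by apply: hs.
have s21 x : E 2%N (E 2%N (E 1%N x)) + E 1%N (E 2%N (E 2%N x))
    = (E 2%N (E 1%N (E 2%N x)) - E 2%N x) *+ 2 by apply: hs.
have b0 : E 2%N v = 0 by apply: hk.
have b1 : E 2%N (E 2%N (E 1%N v)) = 0.
  by have := s21 v; rewrite b0 !linear0 !addr0 mul0rn.
have bab x : E 2%N (E 2%N x) = 0 -> E 2%N (E 2%N (E 1%N x)) =
    (E 2%N (E 1%N (E 2%N x)) - E 2%N x) *+ 2.
  by move=> x0; rewrite -s21 x0 linear0 addr0.
(* The Serre relation at E_1 v, and E_1 applied to the relation at v, both involve E_1 E_2 E_1 E_1 v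
   and E_1 E_1 E_2 E_1 v. Eliminating the latter leaves an affine equation for the former. *)
have aba : E 1%N (E 2%N (E 1%N (E 1%N v))) = E 1%N (E 1%N v) *+ 2.
  have e1 := s12 (E 1%N v); rewrite h3 linear0 addr0 in e1.
  have := congr1 (E 1%N) (s12 v); rewrite b0 !linear0 add0r linearMn linearB /= e1.
  exact: twice_of_affine.
split=> //.
- have := s21 (E 1%N (E 1%N v)); rewrite h3 !linear0 add0r aba => ->.
  by rewrite linearMn /= mulr2n addrK.
- by rewrite bab // linearMn linearB /= b1 subr0 bab ?b1 ?linear0 // !(linear0, addr0, mul0rn).
Qed.

(* The vectors 2 u_0 u_j, for v = u_0^2. *)
Fixpoint edge_row j : M :=
  match j with
  | 0 => v *+ 2
  | j'.+1 => E j'.+1 (if j' is 0 then v else edge_row j')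
  end.

(** E_k commutes with the operators that built the vector and annihilates v. The [if] mirrors
    [edge_row], whose first step starts from v rather than 2v, since E_1 takes u_0^2 to 2 u_0
    u_1. *)
Lemma edge_row_above k j : (j.+1 < k <= n)%N ->
  E k (if j is 0 then v else edge_row j) = 0.
Proof.
have [[hc _] [_ hk _]] := (hE, hv).
elim: j k => [|j IH] k jk /=; first by apply: hk; lia.
by rewrite -hc ?IH ?linear0 //; lia.
Qed.

(** [edge_row k] is E_k E_(k-1) y with E_k y = 0, so the Serre relation for k and k-1 at y leaves
    only E_k E_k E_(k-1) y = 0. *)
Lemma edge_row_diag k : (1 < k <= n)%N -> E k (edge_row k) = 0.
Proof.
have [[_ hs] _] := (hE, hv).
case: k => [|[|k]] // kn; rewrite /edge_row -/edge_row.
set y := if k is 0 then v else edge_row k.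
have y0 : E k.+2 y = 0 by apply: edge_row_above; lia.
have /= := hs k.+2 k.+1 y; rewrite y0 !(linear0, addr0, mul0rn); apply; try lia.
by rewrite /adj; lia.
Qed.

(** Write [edge_row k] as E_k y. In the Serre relation for k and k+1 at y the left side vanishes by
    the two preceding lemmas. *)
Lemma edge_row_lower k : (1 < k < n)%N -> E k (edge_row k.+1) = edge_row k.
Proof.
have [[_ hs] _] := (hE, hv).
case: k => [|k] // kn; rewrite /edge_row -/edge_row.
set y := if k is 0 then v else edge_row k.
have y0 : E k.+2 y = 0 by apply: (@edge_row_above k.+2 k); lia.
have := @edge_row_diag k.+1; rewrite /edge_row -/edge_row -/y => d.
have e : (E k.+1 (E k.+2 (E k.+1 y)) - E k.+1 y) *+ 2 = 0 *+ 2.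
  rewrite -hs; try by rewrite /adj; lia.
  by rewrite y0 d ?linear0 ?addr0 ?mul0rn //; lia.
by apply/eqP; rewrite -subr_eq0; apply/eqP; apply: mulrn_inj e.
Qed.

Lemma edge_row_act k j : (1 < k <= n)%N -> (j <= n)%N ->
  E k (edge_row j) = edge_row k *+ adj k j.
Proof.
have [[hc _] [_ hk _]] := (hE, hv).
move=> kn jn; case: (ltngtP k j) => [kj|jk|<-]; last first.
- by rewrite edge_row_diag // (_ : adj k k = false) //; rewrite /adj; lia.
- case: j jk jn => [|j] jk jn.
    rewrite linearMn hk ?mul0rn; last by lia.
    by rewrite (_ : adj k 0 = false) //; rewrite /adj; lia.
  have [ekj|nkj] := eqVneq k j.+2.
    by rewrite ekj (_ : adj _ _ = true) //; rewrite /adj eqxx.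
  rewrite (_ : adj _ _ = false); last by rewrite /adj; lia.
  by apply: (@edge_row_above k j.+1); lia.
elim: j kj jn => // j IH kj jn.
have [ekj|nkj] := eqVneq k j.
  rewrite -ekj (_ : adj _ _ = true); last by rewrite /adj eqxx orbT.
  by apply: edge_row_lower; lia.
have j0 : j != 0%N by lia.
rewrite (_ : adj _ _ = false); last by rewrite /adj; lia.
have -> : edge_row j.+1 = E j.+1 (edge_row j) by case: (j) j0.
rewrite hc; last by lia.
rewrite IH; try lia.
rewrite linearMn -[E j.+1 (edge_row k)]/(_).
(* Only j = k+1 leaves a nonzero multiple of E_(k+2) [(edge_row k)], and that vector is zero. *)
have [ekj|nkj'] := eqVneq j k.+1.
  case: k kn kj IH nkj ekj => // k kn kj IH nkj ekj.
  rewrite ekj; have := @edge_row_above k.+3 k.+1; rewrite /= => -> //; last by lia.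
  by rewrite mul0rn.
by rewrite (_ : adj _ _ = false) //; rewrite /adj; lia.
Qed.

Lemma edge_row_act0 j : (j <= n)%N -> E 0%N (edge_row j) = (v *+ 2) *+ (j == 1)%N.
Proof.
have [[hc _] [h0 hk h1]] := (hE, hv).
case: j => [|[|j]] jn; first by rewrite /= linearMn h0 mul0rn.
  by have [|h _ _] := h1; rewrite /= ?h.
elim: j jn => [|j IH] jn.
  rewrite /= hc; last by lia.
  have [|-> _ _] := h1; first by lia.
  by rewrite linearMn hk ?mul0rn.
have -> : edge_row j.+3 = E j.+3 (edge_row j.+2) by [].
rewrite hc; last by lia.
by rewrite IH ?linear0 //; lia.
Qed.

(* W' is the family 2 u_i u_j for i, j >= 1, with indices shifted by one. *)
Section Family.
Variable W' : nat -> nat -> M.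
Hypotheses (hW : square_family n (fun k => E k.+1) W').
Hypothesis (W'00 : (0 < n)%N -> W' 0%N 0%N = E 1%N (E 1%N v)).

Lemma edge_row_act1 j : (0 < n)%N -> (j <= n)%N ->
  E 1%N (edge_row j) =
  (if j is j'.+1 then W' 0%N j' else edge_row 1) + edge_row 1 *+ adj 1 j.
Proof.
have [[hc hs] [h0 hk h1]] := (hE, hv); have [Ws Wa] := hW => n0.
have {h1} [_ _ h3] := h1 n0.
case: j => [|[|j]] jn; first by rewrite /= linearMn mulr2n.
  by rewrite /= addr0 W'00.
elim: j jn => [|j IH] jn.
  (* At j = 2, since E_2 v = 0, the Serre relation at v gives E_2 E_1 E_1 v = 2 (E_1 E_2 E_1 v - E_1
     v), while the left side is E_2 [(W' 0 0)], that is, twice [W' 0 1]. *)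
  have /= w1 := Wa 1%N 0%N 0%N jn n0 n0; rewrite W'00 // Ws -mulr2n in w1.
  have e : (E 1%N (E 2%N (E 1%N v)) - E 1%N v) *+ 2 = W' 0%N 1%N *+ 2.
    rewrite -hs; try by rewrite /adj; lia.
    by rewrite (hk 2%N) ?linear0 ?add0r ?w1 //; lia.
  by apply/eqP; rewrite /= -subr_eq; apply/eqP; apply: mulrn_inj e.
have -> : edge_row j.+3 = E j.+3 (edge_row j.+2) by [].
rewrite (hc 1%N); last by lia.
rewrite IH; last by lia.
rewrite linearD linearMn edge_row_act; try lia.
have /= -> := Wa j.+2 0%N j.+1 _ n0 _; try lia.
rewrite (_ : adj j.+2 j.+1 = true); last by rewrite /adj; lia.
by rewrite !(mulr0n, mul0rn, addr0, add0r).
Qed.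

(** E_0 commutes with every operator that raises an index of W', so all values follow from E_0 E_1
    E_1 v = 2 E_1 v at [W' 0 0]. *)
Lemma subfamily_act0 i j : (i <= j < n)%N ->
  E 0%N (W' i j) = edge_row j.+1 *+ (i == 0)%N + edge_row i.+1 *+ (j == 0)%N.
Proof.
have [[hc _] [h0 hk h1]] := (hE, hv).
have rise l m : (l < m)%N -> (m.+1 < n)%N -> E m.+2 (W' l m) = W' l m.+1.
  exact: square_raise hW.
have rise_diag l : (l.+1 < n)%N -> E l.+2 (W' l l) = W' l l.+1 *+ 2.
  exact: square_raise_diag hW.
have rise_end l : (l.+1 < n)%N -> E l.+2 (W' l l.+1) = W' l.+1 l.+1.
  exact: square_diag hW.
elim: j i => [|j IH] i.
  rewrite leqn0 => /andP[/eqP-> n0]; have [//|_ h _] := h1.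
  by rewrite W'00 // h /= mulr2n.
have raised l : (l <= j)%N -> (j.+1 < n)%N ->
    E 0%N (W' l j.+1) = edge_row j.+2 *+ (l == 0)%N.
  rewrite leq_eqVlt => /predU1P[->|lj] jn.
    apply: (@mulrn_inj _ _ 1); rewrite -linearMn -rise_diag //.
    rewrite hc; last by lia.
    by rewrite IH ?leqnn ?(ltnW jn) // linearD !linearMn mulr2n.
  rewrite -rise // hc; last by lia.
  rewrite IH; last by lia.
  by rewrite (gtn_eqF (leq_ltn_trans (leq0n l) lj)) addr0 linearMn.
rewrite leq_eqVlt ltnS => /andP[/predU1P[->|ij] jn]; last by rewrite raised // addr0.
rewrite -rise_end // hc; last by lia.
by rewrite raised // linearMn edge_row_diag ?mul0rn ?addr0 //; lia.
Qed.

Lemma square_family_step : square_family n.+1 E (fun i j =>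
  match i, j with
  | 0, j => edge_row j
  | i.+1, 0 => edge_row i.+1
  | i.+1, j.+1 => W' i j
  end).
Proof.
have [Ws Wa] := hW; have [[hc _] [h0 hk h1]] := (hE, hv).
set W := (fun i j => _).
have sym i j : W i j = W j i by case: i j => [|i] [|j] //=.
split=> // k i j; wlog ij : i j / (i <= j)%N => [th|] kn iN jn.
  have [/th->|/ltnW/th h] := leqP i j; rewrite // sym h // addrC.
  by rewrite (sym j k) (sym i k) addrC.
case: i ij iN => [_ _|i]; last first.
  case: j jn => // j jn ij iN; case: k kn => [_|k kn]; last by rewrite /W Wa.
  by rewrite /W subfamily_act0; last by lia.
case: k kn => [|[|k]] kn.
- by rewrite edge_row_act0 // (_ : adj 0 0 = false) ?add0r.
- by rewrite edge_row_act1 //; case: (j).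
- by rewrite edge_row_act // (_ : adj _ 0 = false) ?add0r.
Qed.

End Family.
End Step.

Lemma square_family_exists n E v : electrical_ops n E -> corner_vector n E v ->
  exists2 W, square_family n E W & ((0 < n)%N -> W 0%N 0%N = v *+ 2).
Proof.
elim: n E v => [|n IH] E v hE hv; first by exists (fun _ _ => 0).
have [n0|n0] := posnP n.
  subst n; exists (fun _ _ => v *+ 2) => //; split=> // k i j.
  rewrite !ltnS !leqn0 => /eqP-> /eqP-> /eqP->.
  by have [h0 _ _] := hv; rewrite linearMn h0 mul0rn (_ : adj 0 0 = false) // addr0.
(* E_1 E_1 v is 2 u_1^2; halving it gives the corner u_1^2, so that [W' 0 0] is E_1 E_1 v itself. *)
have [W' hW W00] := IH _ _ (electrical_ops_behead hE)
  (corner_vector_scale 2%:R^-1 (corner_vector_step hE hv n0)).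
exists (fun i j => match i, j with
  | 0, j => edge_row E v j
  | i.+1, 0 => edge_row E v i.+1
  | i.+1, j.+1 => W' i j
  end) => //.
apply: square_family_step => // _.
by rewrite W00 // -scaler_nat scalerA divff ?scale1r // pnatr_eq0.
Qed.
End Chain.

(** The raising operators, which f intertwines, generate the family from [W 0 0]; the factor 2 met
    on leaving the diagonal is cancelled. *)
Lemma square_family_hom (K : numFieldType) (M M' : lmodType K) n
    (E : nat -> {linear M -> M}) (E' : nat -> {linear M' -> M'})
    (f : {linear M -> M'}) W W' :
  square_family n E W -> square_family n E' W' ->
  (forall k x, (k < n)%N -> f (E k x) = E' k (f x)) ->
  ((0 < n)%N -> f (W 0%N 0%N) = W' 0%N 0%N) ->
  forall i j, (i < n)%N -> (j < n)%N -> f (W i j) = W' i j.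
Proof.
move=> hW hW' fE f0; have [[Ws _] [Ws' _]] := (hW, hW').
suff le j i : (i <= j < n)%N -> f (W i j) = W' i j.
  move=> i j iN jn; have [ij|/ltnW ij] := leqP i j; first by apply: le; lia.
  by rewrite Ws Ws' le // ij.
elim: j i => [|j IH] i; first by rewrite leqn0 => /andP[/eqP-> n0]; apply: f0.
have raised l : (l <= j)%N -> (j.+1 < n)%N -> f (W l j.+1) = W' l j.+1.
  rewrite leq_eqVlt => /predU1P[->|lj] jn.
    apply: (@mulrn_inj _ _ 1); rewrite -linearMn -(square_raise_diag hW) //.
    by rewrite -(square_raise_diag hW') // fE // IH // leqnn ltnW.
  by rewrite -(square_raise hW) // -(square_raise hW') // fE // IH // (ltnW lj) ltnW.
rewrite leq_eqVlt ltnS => /andP[/predU1P[->|ij] jn]; last by rewrite raised.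
by rewrite -(square_diag hW) // -(square_diag hW') // fE // raised.
Qed.

(** * Electrical relations in a Lie algebra *)

Section LieTheory.
Variables (K : fieldType) (L : lieAlgType K).
Implicit Types x y z : L.

HB.instance Definition _ x :=
  GRing.isLinear.Build K L L *:%R (lie_br x) (lie_br_linearr x).

Definition lie_ad x : {linear L -> L} := lie_br x.

Lemma lie_brDl x y z : [lie x + y, z] = [lie x, z] + [lie y, z].
Proof. by have /= := lie_br_linearl z 1 x y; rewrite !scale1r. Qed.

Lemma lie_brC x y : [lie x, y] = - [lie y, x].
Proof.
apply/eqP; rewrite -addr_eq0; apply/eqP.
by have := lie_brxx (x + y); rewrite lie_brDl !linearD /= !lie_brxx add0r addr0.
Qed.

Lemma lie_br0l x : [lie 0, x] = 0.
Proof. by rewrite lie_brC linear0 oppr0. Qed.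

Lemma lie_brZl a x y : [lie a *: x, y] = a *: [lie x, y].
Proof. by rewrite lie_brC linearZ /= -scalerN -lie_brC. Qed.

Lemma lie_leibniz x y z : [lie x, [lie y, z]] = [lie [lie x, y], z] + [lie y, [lie x, z]].
Proof.
have := lie_jacobi x y z; rewrite (lie_brC z x) linearN (lie_brC z) /=.
by move/eqP; rewrite -addrA -opprD subr_eq0 addrC => /eqP.
Qed.

Lemma lie_brA x y z : [lie [lie x, y], z] = [lie x, [lie y, z]] - [lie y, [lie x, z]].
Proof. by rewrite lie_leibniz addrK. Qed.

End LieTheory.

Section Systems.
Variables (K : numFieldType) (L : lieAlgType K).
Implicit Types (n : nat) (e : nat -> L).

Definition electrical_A n e :=
  (forall i j, (i.+1 < j < n)%N -> [lie e i, e j] = 0) /\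
  (forall i j, (i < n)%N -> (j < n)%N -> adj i j ->
     [lie e i, [lie e i, e j]] = (- 2%:R) *: e i).

Definition electrical_B n e :=
  [/\ forall i j, (i.+1 < j < n)%N -> [lie e i, e j] = 0,
      forall i j, (i < n)%N -> (j < n)%N -> adj i j -> (i, j) <> (1, 0)%N ->
        [lie e i, [lie e i, e j]] = (- 2%:R) *: e i
    & (1 < n)%N -> [lie e 1%N, [lie e 1%N, [lie e 1%N, e 0%N]]] = 0].

Definition lie_square n e U :=
  square_family n (fun k => lie_ad (e k)) U /\ U 0%N 0%N = e 0%N *+ 2.

Lemma electrical_AB n e : electrical_A n e -> electrical_B n e.
Proof.
case=> hc hs; split=> // [i j iN jn ij _|n1]; first exact: hs.
by rewrite hs // ?linearZ /= ?lie_brxx ?scaler0 // ltnW.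
Qed.

Lemma lie_square_exists n e : electrical_B n e -> exists U, lie_square n e U.
Proof.
case=> hc hs h1.
have [||U hU U0] := @square_family_exists K L n (fun k => lie_ad (e k)) (e 0%N).
- split=> [i j x ij | i j x /andP[i0 iN] /andP[j0 jn] ij] /=.
    by rewrite lie_leibniz hc // lie_br0l add0r.
  (* This is the adjoint form of [e_i, [e_i, e_j]] = -2 e_i, with the double bracket expanded. Both
     nodes are positive, so the exceptional pair (1, 0) does not occur. *)
  rewrite mulrnBl -scaler_nat -[in X in _ - X]scaler_nat -scaleNr.
  rewrite -[(- _) *: _]lie_brZl -(hs i j) //; last by case=> _ j1; rewrite j1 in j0.
  rewrite !lie_brA linearB /= scaler_nat mulr2n.
  set p := [lie e i, [lie e i, _]]; set q := [lie e j, _].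
  set r := [lie e i, [lie e j, _]].
  by rewrite opprB (addrACA p) -opprD [RHS]addrC subrK.
- split=> [|k /andP[k1 kn]|n1] /=; first exact: lie_brxx.
    by rewrite lie_brC hc ?oppr0 // k1.
  have e01 : [lie e 0%N, [lie e 1%N, e 0%N]] = e 0%N *+ 2.
    by rewrite (lie_brC (e 1%N)) linearN /= hs // ?scaleNr ?opprK ?scaler_nat // ltnW.
  split=> //; last exact: h1.
  (* Leibniz splits off [[e_0, e_1], [e_1, e_0]] = 0 and leaves [e_1, 2 e_0]. *)
  rewrite lie_leibniz e01 linearMn /= (lie_brC (e 0%N)) -scaleN1r lie_brZl.
  by rewrite lie_brxx scaler0 add0r.
have [n0|n0] := posnP n; last by exists U; split=> //; rewrite U0.
by exists (fun _ _ => e 0%N *+ 2); split=> //; split=> // k i j; rewrite n0.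
Qed.

Lemma lie_square_hom (L' : lieAlgType K) n (e : nat -> L) (e' : nat -> L')
    U U' (f : {linear L -> L'}) :
  lie_morphism f -> (forall k, (k < n)%N -> f (e k) = e' k) ->
  square_family n (fun k => lie_ad (e k)) U ->
  square_family n (fun k => lie_ad (e' k)) U' ->
  ((0 < n)%N -> f (U 0%N 0%N) = U' 0%N 0%N) ->
  forall i j, (i < n)%N -> (j < n)%N -> f (U i j) = U' i j.
Proof.
move=> hf fe hU hU'; apply: (square_family_hom hU hU') => k x kn /=.
by rewrite hf fe.
Qed.

(** Raising twice applies ad(e_(k+1))^2, which turns e_k into -2 e_(k+1); hence the alternating
    sign. In type A every generator therefore lies in the span of U. *)
Lemma lie_square_diag n e U k : electrical_A n e -> lie_square n e U ->
  (k < n)%N -> U k k = (-1) ^+ k *: (e k *+ 2).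
Proof.
move=> [hc hs] [hU U0]; elim: k => [|k IH] kn; first by rewrite scale1r.
apply: (@mulrn_inj _ _ 1).
rewrite -(square_diag hU) // -linearMn -(square_raise_diag hU) // IH ?(ltnW kn) //.
rewrite !linearZ !linearMn /= hs ?(ltnW kn) //; last by rewrite /adj eqxx.
by rewrite exprS mulN1r -!scaler_nat !scalerA; congr (_ *: _); ring.
Qed.
End Systems.

(** * Presented Lie algebras *)

Section Presentations.
Variables (K : fieldType) (I : Type) (rel : lie_word K I -> lie_word K I -> Prop).
Local Notation P := (lie_pres rel).
Local Notation gen := (lie_gen rel).

Section Ideal.
Variable S : P -> Prop.
Hypotheses (S0 : S 0) (SP : forall a x y, S x -> S y -> S (a *: x + y)).
Hypothesis (Sgen : forall i x, S x -> S [lie gen i, x]).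

(** Induction on a word for x. Brackets are handled by [[s, t], y] = [s, [t, y]] - [t, [s, y]], so
    stability under the generators suffices. *)
Lemma pres_ideal x y : S y -> S [lie x, y].
Proof.
have SZ a z : S z -> S (a *: z) by move=> Sz; rewrite -[_ *: _]addr0; apply: SP.
elim/pclass_ind: x y; elim=> [i||s IHs|s IHs t IHt|a s IHs|s IHs t IHt] y Sy.
- exact: Sgen.
- rewrite -[pclass _ _]/(0 : P) lie_br0l; exact: S0.
- rewrite -poppE -[popp _]/(- pclass rel s) -scaleN1r lie_brZl; auto.
- rewrite -paddE lie_brDl -[X in S (X + _)]scale1r; apply: SP; auto.
- rewrite -pscaleE lie_brZl; auto.
- rewrite -pbrE -[pbr _ _]/([lie _, _] : P) lie_brA addrC -scaleN1r; apply: SP; auto.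
Qed.

Lemma pres_all : (forall i, S (gen i)) -> forall x, S x.
Proof.
have SZ a z : S z -> S (a *: z) by move=> Sz; rewrite -[_ *: _]addr0; apply: SP.
move=> Sg; elim/pclass_ind; elim=> [i||s IHs|s IHs t IHt|a s IHs|s IHs t IHt].
- exact: Sg.
- exact: S0.
- rewrite -poppE -[popp _]/(- pclass rel s) -scaleN1r; exact: SZ.
- rewrite -paddE -[pclass _ s]scale1r; exact: SP.
- rewrite -pscaleE; exact: SZ.
- rewrite -pbrE; exact: pres_ideal.
Qed.
End Ideal.

End Presentations.

(** * Linear combinations of a square family *)

Section Combinations.
Variables (K : numFieldType) (M : lmodType K) (n : nat).
Implicit Types (U : nat -> nat -> M) (A B : 'M[K]_n).

(** A is an arbitrary matrix, not one indexed by i <= j. For symmetric U it matters only up to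
    antisymmetric matrices, so freeness of U is expressed as A + A^T = 0. *)
Definition square_comb U A : M := \sum_(i < n) \sum_(j < n) A i j *: U i j.

Lemma square_comb_linear U : linear (square_comb U).
Proof.
move=> a A B; rewrite /square_comb scaler_sumr -big_split; apply: eq_bigr => i _.
rewrite scaler_sumr -big_split; apply: eq_bigr => j _.
by rewrite !mxE scalerDl scalerA.
Qed.
HB.instance Definition _ U :=
  GRing.isLinear.Build K 'M[K]_n M *:%R (square_comb U) (square_comb_linear U).

Lemma square_comb_delta U i j : square_comb U (delta_mx i j) = U i j.
Proof.
rewrite /square_comb (bigD1 i) //= (bigD1 j) //= mxE !eqxx scale1r.
rewrite big1 => [|j' /negPf nj]; last by rewrite mxE nj andbF scale0r.
rewrite addr0 big1 ?addr0 // => i' /negPf ni; rewrite big1 // => j' _.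
by rewrite mxE ni scale0r.
Qed.

Lemma square_comb_tr U A : (forall i j, U i j = U j i) ->
  square_comb U A^T = square_comb U A.
Proof.
move=> Us; rewrite /square_comb exchange_big; apply: eq_bigr => i _.
by apply: eq_bigr => j _; rewrite mxE Us.
Qed.

Lemma square_comb_sym0 U A : (forall i j, U i j = U j i) -> A + A^T = 0 ->
  square_comb U A = 0.
Proof.
move=> Us hA; apply: (@mulrn_inj _ _ 1).
by rewrite mul0rn mulr2n -{2}(square_comb_tr A Us) -linearD hA linear0.
Qed.

Lemma square_comb_act E U A k : square_family n E U -> (k < n)%N ->
  exists B, E k (square_comb U A) = square_comb U B.
Proof.
move=> [_ Ua] kn; pose ko := Ordinal kn.
exists (\sum_(i < n) \sum_(j < n)
  A i j *: (delta_mx ko j *+ adj k i + delta_mx i ko *+ adj k j)).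
rewrite {1}/square_comb !linear_sum; apply: eq_bigr => i _.
rewrite !linear_sum; apply: eq_bigr => j _.
by rewrite !linearZ linearD !linearMn /= !square_comb_delta Ua.
Qed.
End Combinations.

Lemma square_comb_hom (K : numFieldType) (M M' : lmodType K) n
    (f : {linear M -> M'}) U U' (A : 'M[K]_n) :
  (forall i j, (i < n)%N -> (j < n)%N -> f (U i j) = U' i j) ->
  f (square_comb U A) = square_comb U' A.
Proof.
move=> fU; rewrite !linear_sum; apply: eq_bigr => i _.
by rewrite linear_sum; apply: eq_bigr => j _; rewrite linearZ /= fU.
Qed.

(** * Generators of a presented algebra, numbered from 0 *)

Section Nodes.
Variables (K : numFieldType) (lo hi : nat).
Variable rel : lie_word K (node lo hi) -> lie_word K (node lo hi) -> Prop.
Local Notation n := (hi.+1 - lo)%N.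

(* The generator of node lo + k, or 0 if there is no such node. *)
Definition node_seq k : lie_pres rel :=
  if insub (lo + k)%N is Some i then lie_gen rel i else 0.

Lemma node_seqE (i : node lo hi) k : val i = (lo + k)%N -> node_seq k = lie_gen rel i.
Proof.
by move=> ei; rewrite /node_seq -ei (valK (i : {m | (lo <= m <= hi)%N})).
Qed.

Lemma node_seq_gen (i : node lo hi) : lie_gen rel i = node_seq (val i - lo).
Proof. by apply/esym/node_seqE; case: i => m /= h; lia. Qed.

Lemma node_of k : (k < n)%N -> exists i : node lo hi, val i = (lo + k)%N.
Proof.
move=> kn; have h : (lo <= lo + k <= hi)%N by lia.
by exists (exist _ (lo + k)%N h).
Qed.

Lemma node_bound (i : node lo hi) : (val i - lo < n)%N.
Proof. by case: i => m /= h; lia. Qed.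

Lemma pres_rel s t : rel s t -> pclass rel s = pclass rel t.
Proof. by move=> h; apply/pclassP/cong_rel. Qed.

Lemma pres_ideal_seq (S : lie_pres rel -> Prop) : S 0 ->
  (forall a x y, S x -> S y -> S (a *: x + y)) ->
  (forall k x, (k < n)%N -> S x -> S [lie node_seq k, x]) ->
  forall x y, S y -> S [lie x, y].
Proof.
move=> S0 SP Sg; apply: pres_ideal => // i x Sx.
by rewrite node_seq_gen; apply: Sg => //; apply: node_bound.
Qed.

Lemma pres_all_seq (S : lie_pres rel -> Prop) : S 0 ->
  (forall a x y, S x -> S y -> S (a *: x + y)) ->
  (forall k x, (k < n)%N -> S x -> S [lie node_seq k, x]) ->
  (forall k, (k < n)%N -> S (node_seq k)) -> forall x, S x.
Proof.
move=> S0 SP Sg Sn; apply: pres_all => // i; last first.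
  by rewrite node_seq_gen; apply/Sn/node_bound.
by move=> x Sx; rewrite node_seq_gen; apply: Sg => //; apply: node_bound.
Qed.
End Nodes.

(** * The electrical Lie algebra of type A *)

Section ElectricalA.
Variables (K : numFieldType) (lo hi : nat).
Local Notation n := (hi.+1 - lo)%N.
Local Notation eA := (eA_nodes K lo hi).

Definition eA_seq : nat -> eA := node_seq (@eA_rel K lo hi).

Lemma eA_seqP : electrical_A n eA_seq.
Proof.
split=> [i j ij|i j iN jn ij].
  have [i' ei] : exists i' : node lo hi, val i' = (lo + i)%N by apply: node_of; lia.
  have [j' ej] : exists j' : node lo hi, val j' = (lo + j)%N by apply: node_of; lia.
  rewrite /eA_seq (node_seqE _ ei) (node_seqE _ ej).
  rewrite /lie_br /= pbrE; apply: pres_rel; apply: eA_comm; rewrite ei ej; lia.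
have [i' ei] := node_of iN; have [j' ej] := node_of jn.
rewrite /eA_seq (node_seqE _ ei) (node_seqE _ ej).
rewrite /lie_gen /lie_br /= !pbrE [RHS]pscaleE; apply: pres_rel; apply: eA_serre.
by rewrite ei ej; move: ij; rewrite /adj; lia.
Qed.

Lemma eA_hom (L : lieAlgType K) (e : nat -> L) : electrical_A n e ->
  exists phi : {linear eA -> L}, lie_morphism phi /\
    forall k, (k < n)%N -> phi (eA_seq k) = e k.
Proof.
move=> [hc hs].
have [|phi [hphi phig]] :=
  @lie_pres_univ K (node lo hi) (@eA_rel K lo hi) L (fun i => e (val i - lo)%N).
  move=> _ _ [i j ij|i j ij] /=; have iN := node_bound i; have jn := node_bound j.
    case: i j iN jn ij => [i /= hi'] [j /= hj] iN jn ij.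
    have [lt|lt] : (i.+1 < j \/ j.+1 < i)%N by lia.
      by apply: hc; lia.
    by rewrite lie_brC hc ?oppr0 //; lia.
  apply: hs => //; move: ij; case: i j {iN jn} => [i /= hi'] [j /= hj].
  by rewrite /adj; lia.
exists phi; split=> // k kn; have [i ei] := node_of kn.
by rewrite /eA_seq (node_seqE _ ei) phig ei addKn.
Qed.

Lemma eA_span U : lie_square n eA_seq U ->
  forall x, exists A : 'M[K]_n, x = square_comb U A.
Proof.
move=> hU; have [hf _] := hU.
apply: pres_all_seq => [|a x y [A ->] [B ->]|k x kn [A ->]|k kn].
- by exists 0; rewrite linear0.
- by exists (a *: A + B); rewrite linearP.
- exact: (square_comb_act A hf kn).
(* The coefficient inverts U_kk = (-1)^k 2 e_k. *)
exists (((-1) ^+ k / 2%:R) *: delta_mx (Ordinal kn) (Ordinal kn)).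
rewrite linearZ /= square_comb_delta /= (lie_square_diag eA_seqP hU kn).
rewrite -scaler_nat !scalerA mulrAC divfK ?pnatr_eq0 //.
by rewrite -expr2 sqrr_sign scale1r.
Qed.
End ElectricalA.

Section Bijections.
Variables (K : numFieldType) (L1 L2 : lieAlgType K).

Lemma linear_bijective (f : {linear L1 -> L2}) :
  (forall x, f x = 0 -> x = 0) -> (forall y, exists x, f x = y) -> bijective f.
Proof.
move=> f0 /choice[g fg].
have f_inj x y : f x = f y -> x = y.
  by move=> e; apply/eqP; rewrite -subr_eq0; apply/eqP/f0; rewrite linearB e subrr.
by exists g => // x; apply: f_inj; rewrite fg.
Qed.
End Bijections.

(* L has a basis behaving as the u_i u_j, i <= j < n. *)
Definition square_model (K : numFieldType) (L : lieAlgType K) n :=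
  exists e : nat -> L, exists U, [/\ electrical_A n e, lie_square n e U,
    forall x, exists A : 'M[K]_n, x = square_comb U A
  & forall A : 'M[K]_n, square_comb U A = 0 -> A + A^T = 0].

(** The homomorphism given by the presentation carries the spanning family W to U: freeness of U
    gives injectivity, spanning by U surjectivity. *)
Lemma eA_iso (K : numFieldType) (L : lieAlgType K) lo hi :
  square_model L (hi.+1 - lo)%N -> lie_isomorphic (eA_nodes K lo hi) L.
Proof.
move=> [e [U [he hU Uspan Ufree]]]; have [phi [phiM phie]] := eA_hom he.
have [W hW] := lie_square_exists (electrical_AB (eA_seqP K lo hi)).
have phiW i j : (i < hi.+1 - lo)%N -> (j < hi.+1 - lo)%N -> phi (W i j) = U i j.
  apply: (lie_square_hom phiM phie hW.1 hU.1) => n0.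
  by rewrite hW.2 hU.2 linearMn /= phie.
exists phi; split=> //; apply: linear_bijective => [x|y].
  have [A ->] := eA_span hW x; rewrite (square_comb_hom _ phiW) => /Ufree.
  by apply: square_comb_sym0; have [[]] := hW.
by have [A ->] := Uspan y; exists (square_comb W A); rewrite (square_comb_hom _ phiW).
Qed.

(** Independence is pulled back along the homomorphism to the model. It serves for injectivity in
    type B. *)
Lemma eA_free (K : numFieldType) (L : lieAlgType K) lo hi W :
  square_model L (hi.+1 - lo)%N ->
  lie_square (hi.+1 - lo) (eA_seq K lo hi) W ->
  forall A : 'M[K]_(hi.+1 - lo), square_comb W A = 0 -> A + A^T = 0.
Proof.
move=> [e [U [he hU Uspan Ufree]]] hW A hA; have [phi [phiM phie]] := eA_hom he.
apply: Ufree; rewrite -(square_comb_hom (f := phi) (U := W)) ?hA ?linear0 //.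
apply: (lie_square_hom phiM phie hW.1 hU.1) => n0.
by rewrite hW.2 hU.2 linearMn /= phie.
Qed.

(** * Type B *)

Section Pairs.
Variables (K : fieldType) (L1 L2 : lieAlgType K).

Lemma pair_br (x y : (L1 * L2)%type) :
  [lie x, y] = ([lie x.1, y.1], [lie x.2, y.2]).
Proof. by []. Qed.

Definition lie_inl (x : L1) : (L1 * L2)%type := (x, 0).

Lemma lie_inl_linear : linear lie_inl.
Proof. by move=> a x y; congr (_, _); rewrite /= scaler0 addr0. Qed.
HB.instance Definition _ :=
  GRing.isLinear.Build K L1 (L1 * L2)%type *:%R lie_inl lie_inl_linear.

Lemma lie_inl_br u x : [lie u, lie_inl x] = lie_inl [lie u.1, x].
Proof. by rewrite pair_br linear0. Qed.
End Pairs.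

Section ElectricalB.
Variables (K : numFieldType) (n : nat).
Local Notation eB := (eB K n).
Local Notation n1 := (n.+1 - 1)%N.
Local Notation n2 := (n.+1 - 2)%N.

Definition eB_seq : nat -> eB := node_seq (@eB_rel K n).

Lemma eB_seqP : electrical_B n eB_seq.
Proof.
have nE : n1 = n by rewrite subn1.
split=> [i j ij|i j iN jn ij nij|n1].
- have [i' ei] : exists i' : node 1 n, val i' = (1 + i)%N by apply: node_of; lia.
  have [j' ej] : exists j' : node 1 n, val j' = (1 + j)%N by apply: node_of; lia.
  rewrite /eB_seq (node_seqE _ ei) (node_seqE _ ej).
  rewrite /lie_gen /lie_br /= pbrE; apply: pres_rel; apply: eB_comm; rewrite ei ej; lia.
- have [i' ei] : exists i' : node 1 n, val i' = (1 + i)%N by apply: node_of; lia.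
  have [j' ej] : exists j' : node 1 n, val j' = (1 + j)%N by apply: node_of; lia.
  rewrite /eB_seq (node_seqE _ ei) (node_seqE _ ej).
  rewrite /lie_gen /lie_br /= !pbrE [RHS]pscaleE; apply: pres_rel; apply: eB_serre.
    by rewrite ei ej; move: ij; rewrite /adj; lia.
  by rewrite ei ej => -[h1 h2]; apply: nij; congr (_, _); lia.
have [i' ei] : exists i' : node 1 n, val i' = (1 + 1)%N by apply: node_of; lia.
have [j' ej] : exists j' : node 1 n, val j' = (1 + 0)%N by apply: node_of; lia.
rewrite /eB_seq (node_seqE _ ei) (node_seqE _ ej).
by rewrite /lie_gen /lie_br /= !pbrE; apply: pres_rel; apply: eB_serre21.
Qed.

Lemma eB_hom (L : lieAlgType K) (e : nat -> L) : electrical_B n e ->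
  exists phi : {linear eB -> L}, lie_morphism phi /\
    forall k, (k < n)%N -> phi (eB_seq k) = e k.
Proof.
have nE : n1 = n by rewrite subn1.
move=> [hc hs h1].
have [|phi [hphi phig]] :=
  @lie_pres_univ K (node 1 n) (@eB_rel K n) L (fun i => e (val i - 1)%N).
  move=> _ _ [i j ij|i j ij nij|i j ei ej] /=;
    have iN := node_bound i; have jn := node_bound j; rewrite nE in iN jn.
  - case: i j iN jn ij => [i /= hi'] [j /= hj] iN jn ij.
    have [lt|lt] : (i.+1 < j \/ j.+1 < i)%N by lia.
      by apply: hc; lia.
    by rewrite lie_brC hc ?oppr0 //; lia.
  - apply: hs => //; move: ij nij {iN jn}; case: i j => [i /= hi'] [j /= hj].
      by rewrite /adj; lia.
    by move=> _ nij [i2 j1]; apply: nij; congr (_, _); lia.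
  - by rewrite ei in iN; rewrite -/(val i) -/(val j) ei ej; apply: h1.
exists phi; split=> // k kn.
have [i ei] : exists i : node 1 n, val i = (1 + k)%N by apply: node_of; lia.
by rewrite /eB_seq (node_seqE _ ei) phig ei addKn.
Qed.

Local Notation eA1 := (eA_nodes K 1 n).
Local Notation eA2 := (eA_nodes K 2 n).

(** The second algebra starts at node 2, so its generator of index k' carries the same label as the
    one of index k'+1 in the first. *)
Definition eB_image k : (eA1 * eA2)%type :=
  (eA_seq K 1 n k, if k is k'.+1 then eA_seq K 2 n k' else 0).

(** In the second factor e_0 goes to 0, so [e_1, [e_1, e_0]] = -2 e_1 would force f_2 = 0 there;
    this is exactly the pair excepted in type B. *)
Lemma eB_imageP : electrical_B n eB_image.
Proof.
have [c1 s1 t1] := electrical_AB (eA_seqP K 1 n).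
have [c2 s2] := eA_seqP K 2 n.
split=> [i j ij|i j iN jn ij nij|N1]; rewrite !pair_br /=.
- rewrite c1; last by lia.
  case: i j ij => [|i] [|j] //= ij; first by rewrite lie_br0l.
  by rewrite c2 //; lia.
- rewrite s1 //; try lia.
  case: i j iN jn ij nij => [|i] [|j] //= iN jn ij nij.
  + by rewrite lie_br0l; congr (_, _); rewrite scaler0.
  + by case: i nij ij {iN} => // [] [].
  + by rewrite s2 //; try lia; move: ij; rewrite /adj; lia.
- rewrite t1; last by lia.
  by rewrite !linear0.
Qed.

Lemma eB_to_eA_iso (L1 : lieAlgType K) : (0 < n)%N -> square_model L1 n1 ->
  exists phi : {linear eB -> (eA1 * eA2)%type}, lie_isomorphism phi /\
    forall k, (k < n)%N -> phi (eB_seq k) = eB_image k.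
Proof.
move=> n0 hL1; have nE : n1 = n by rewrite subn1.
have [phi [phiM phie]] := eB_hom eB_imageP; exists phi; split=> //; split=> //.
have [W1 hW1] := lie_square_exists (electrical_AB (eA_seqP K 1 n)).
have W1free := eA_free hL1 hW1; have W1span := eA_span hW1.
have [W [hW W0]] := lie_square_exists eB_seqP.
rewrite nE in hW1 W1free W1span.
(* Away from node 0 the type B relations are those of type A. The resulting map [th] is a section of
   the second component of phi. *)
have [th [thM the]] : exists th : {linear eA2 -> eB}, lie_morphism th /\
    forall k, (k < n2)%N -> th (eA_seq K 2 n k) = eB_seq k.+1.
  apply: eA_hom; have [c s _] := eB_seqP; split=> [i j ij|i j iN jn ij].
    by apply: c; lia.
  by apply: s; rewrite //; lia.
(* W spans the ideal of e_0, and phi sends it into the first summand because [W 0 0] = 2 e_0 goes to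
   (2 f_1, 0). *)
have phiW (A : 'M[K]_n) : phi (square_comb W A) = lie_inl eA2 (square_comb W1 A).
  rewrite [RHS](square_comb_hom (U' := fun i j => lie_inl eA2 (W1 i j))) //.
  apply: square_comb_hom => i j iN jn.
  apply: (lie_square_hom (U' := fun i j => lie_inl eA2 (W1 i j)) phiM phie hW) => // [|_].
    have [[Ws Wa] _] := hW1; split=> [a b|k a b kn aN bn]; first by rewrite Ws.
    by rewrite /= lie_inl_br /= -[[lie _, _]]/(lie_ad _ _) Wa // linearD !linearMn.
  by rewrite W0 linearMn /= phie // hW1.2 linearMn.
have phith y : (phi (th y)).2 = y.
  elim/pres_all_seq: y => [|a x y ex ey|k x kn ex|k kn].
  - by rewrite !linear0.
  - by rewrite !linearP /= ex ey.
  - by rewrite thM phiM /= ex the // phie //=; lia.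
  - by rewrite the // phie //=; lia.
have comb_ideal x (A : 'M[K]_n) : exists B : 'M[K]_n,
    [lie x, square_comb W A] = square_comb W B :> eB.
  pose S y := exists B : 'M[K]_n, y = square_comb W B.
  apply: (pres_ideal_seq (S := S)); last by exists A.
  - by exists 0; rewrite linear0.
  - by move=> a _ _ [B ->] [C ->]; exists (a *: B + C); rewrite linearP.
  - move=> k _ kn [B ->]; rewrite nE in kn; exact: (square_comb_act B hW kn).
have comb0 : exists B : 'M[K]_n, eB_seq 0 = square_comb W B.
  exists (2%:R^-1 *: delta_mx (Ordinal n0) (Ordinal n0)).
  rewrite linearZ /= square_comb_delta /= W0 -scaler_nat scalerA mulVf ?scale1r //.
  by rewrite pnatr_eq0.
have span x : exists A : 'M[K]_n, exists y, x = square_comb W A + th y.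
  elim/pres_all_seq: x => [|a x y [A [u ->]] [B [w ->]]|k x kn [A [u ->]]|k kn].
  - by exists 0, 0; rewrite !linear0 addr0.
  - by exists (a *: A + B), (a *: u + w); rewrite !linearP /= scalerDr addrACA.
  - rewrite linearD /=; have [B ->] := comb_ideal (eB_seq k) A.
    case: k kn => [|k] kn.
      (* [e_0, [th u]] = -[[th u], e_0] stays in the ideal, as e_0 is a combination of W. *)
      have [C eC] := comb0; have [D eD] := comb_ideal (th u) C.
      by exists (B - D), 0; rewrite linear0 addr0 linearB /= -eD -eC -lie_brC.
    by exists B, ([lie eA_seq K 2 n k, u]); rewrite thM the //; lia.
  - case: k kn => [|k] kn; first by have [B hB] := comb0; exists B, 0; rewrite linear0 addr0 -hB.
    by exists 0, (eA_seq K 2 n k); rewrite linear0 add0r the //; lia.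
(* On the kernel, the second component gives y = 0 and freeness of W1 disposes of the rest. For
   surjectivity, [th b] has the right second component and the ideal corrects the first. *)
apply: linear_bijective => [x|[a b]].
  have [A [y ->]] := span x; rewrite linearD /= phiW => h.
  have := congr1 snd h; rewrite /= phith add0r => y0.
  move: h; rewrite y0 !linear0 addr0 => /(congr1 fst) /= /W1free h.
  by rewrite (square_comb_sym0 _ h) ?add0r //; have [] := hW.
have [A hA] := W1span (a - (phi (th b)).1).
exists (square_comb W A + th b); rewrite linearD /= phiW -hA.
rewrite [phi (th b)]surjective_pairing phith /lie_inl.
by congr (_, _); rewrite /= ?subrK ?add0r.
Qed.
End ElectricalB.

(** * The symplectic model *)

Section Omega.
Variables (K : fieldType) (k : nat).
Local Notation Om := (Omega K k).

Lemma Omega_tr : Om^T = - Om.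
Proof. by rewrite /Omega tr_block_mx linearN /= !trmx0 trmx1 opp_block_mx !oppr0 opprK. Qed.

Lemma Omega_sqr : Om *m Om = - 1%:M.
Proof.
rewrite /Omega mulmx_block !mul0mx !mulmx0 !mulmxN !mul1mx !mulNmx !mulmx1 !addr0 !add0r.
by rewrite (scalar_mx_block k k 1) opp_block_mx !oppr0.
Qed.

Lemma Omega_form (x y : 'cV[K]_(k + k)) :
  x^T *m Om *m y = (usubmx x)^T *m dsubmx y - (dsubmx x)^T *m usubmx y.
Proof.
rewrite -{1}(vsubmxK x) -{1}(vsubmxK y) tr_col_mx /Omega mul_row_block mul_row_col.
by rewrite !mulmx0 !mulmxN !mulmx1 add0r addr0 mulNmx addrC.
Qed.

Lemma symplecticP (X : 'M[K]_(k + k)) :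
  reflect (Om *m X = - (X^T *m Om)) (X \in symplectic K k).
Proof.
rewrite unfold_in addrC; apply: (iffP eqP) => [/eqP|->]; rewrite ?addNr //.
by rewrite addr_eq0 => /eqP.
Qed.
End Omega.

(** * A chain of vectors for the symplectic form *)

Section PathBasis.
Variables (K : numFieldType) (k : nat).
Local Notation Om := (Omega K k).

(* With q_a, r_a the two halves of the standard basis: path_vec (2a+1) = q_a and
   path_vec (2a) = r_a + r_(a-1). Only the last vector, q_(k-1), has a nonzero
   q_(k-1)-coordinate, so dropping it gives a basis of the hyperplane used to
   define the odd symplectic algebra. *)
Definition path_vec (i : nat) : 'cV[K]_(k + k) :=
  col_mx (\col_(a < k) (i == a.*2.+1)%:R)
         (\col_(a < k) ((i == a.*2) || (i == a.+1.*2))%:R).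

Lemma sum_indicator (F : nat -> K) b : (b < k)%N ->
  \sum_(a < k) (b == a)%:R * F a = F b.
Proof.
move=> bk; rewrite (bigD1 (Ordinal bk)) //= eqxx mul1r big1 ?addr0 // => a.
by rewrite -val_eqE /= eq_sym => /negPf->; rewrite mul0r.
Qed.

(** The form pairs q_a with r_a to 1, and r_a occurs exactly in the two neighbours of p_(2a+1) =
    q_a. Even i follow by antisymmetry. *)
Lemma path_form i j : (i < k + k)%N -> (j < k + k)%N ->
  (path_vec i)^T *m Om *m path_vec j = ((-1) ^+ i.+1 *+ adj i j)%:M.
Proof.
move=> ik jk; rewrite Omega_form /path_vec !col_mxKu !col_mxKd.
apply/matrixP => u w; rewrite !ord1 !mxE eqxx mulr1n.
have odd_case (l m : nat) : (l < k + k)%N -> odd l ->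
   \sum_(a < k) (l == a.*2.+1)%:R * ((m == a.*2) || (m == a.+1.*2))%:R = (adj l m)%:R :> K.
  move=> lk lo.
  pose F a : K := ((m == a.*2) || (m == a.+1.*2))%:R.
  rewrite (eq_bigr (fun a : 'I_k => (l./2 == a)%:R * F a)) => [|a _].
    rewrite sum_indicator /F; last by lia.
    by congr (_%:R); rewrite /adj; lia.
  by congr (_%:R * _); lia.
have even_case (l m : nat) : ~~ odd l ->
   \sum_(a < k) (l == a.*2.+1)%:R * ((m == a.*2) || (m == a.+1.*2))%:R = 0 :> K.
  by move=> le; rewrite big1 // => a _; rewrite (_ : (l == _) = false) ?mul0r //; lia.
under eq_bigr do rewrite !mxE.
under [X in _ - X]eq_bigr do rewrite !mxE mulrC.
have adj_same : odd i = odd j -> (adj i j = false) * (adj j i = false).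
  by move=> eo; split; apply/negP; rewrite /adj => /orP[] /eqP e;
    move: eo; rewrite e /=; case: odd.
have adj_sym : adj j i = adj i j by rewrite /adj orbC.
rewrite -signr_odd /=.
have [io|ie] := boolP (odd i); have [jo|je] := boolP (odd j).
- by rewrite (odd_case i j) // (odd_case j i) // !adj_same ?io ?jo // subrr.
- by rewrite (odd_case i j) // (even_case j i) // subr0 expr0; case: (adj i j).
- rewrite (even_case i j) // (odd_case j i) // sub0r expr1 adj_sym.
  by case: (adj i j); rewrite ?oppr0.
- by rewrite (even_case i j) // (even_case j i) // adj_same ?(negPf ie) ?(negPf je) // subrr.
Qed.

Definition path_mx : 'M[K]_(k + k) := \matrix_(t, i) path_vec i t 0.

(** If a row vector kills every p_i, odd i give its q-coordinates at once; even i give its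
    r-coordinates in turn, from p_0 = r_0 and p_(2a+2) = r_(a+1) + r_a. *)
Lemma path_mx_unit : path_mx \in unitmx.
Proof.
rewrite -row_free_unit; apply: inj_row_free => v hv.
have vp i : (i < k + k)%N -> v *m path_vec i = 0.
  move=> ik; apply/matrixP => u w.
  have := congr1 (fun M : 'rV[K]_(k + k) => M u (Ordinal ik)) hv.
  rewrite !ord1 !mxE => h; rewrite -[RHS]h; apply: eq_bigr => t _.
  by rewrite [in RHS]mxE.
have vpE i : (i < k + k)%N ->
    \sum_(a < k) lsubmx v 0 a * (i == a.*2.+1)%:R +
    \sum_(a < k) rsubmx v 0 a * ((i == a.*2) || (i == a.+1.*2))%:R = 0.
  move=> /vp; rewrite -{1}(hsubmxK v) mul_row_col => /matrixP/(_ 0 0).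
  by rewrite !mxE => h; rewrite -[RHS]h; congr (_ + _); apply: eq_bigr => a _; rewrite !mxE.
have vl a : lsubmx v 0 a = 0.
  have := vpE a.*2.+1; rewrite (bigD1 a) //= eqxx mulr1.
  rewrite big1 ?addr0 => [|b nb]; last first.
    by rewrite (_ : (_ == _) = false) ?mulr0 //; move: nb; rewrite -val_eqE /=; lia.
  rewrite big1 ?addr0 => [|b _]; last by rewrite (_ : _ || _ = false) ?mulr0 //; lia.
  by apply; have := ltn_ord a; lia.
have vr a (ak : (a < k)%N) : rsubmx v 0 (Ordinal ak) = 0.
  elim: a ak => [|a IH] ak; [have := vpE 0%N|have := vpE a.+1.*2].
    rewrite big1 ?add0r => [|b _]; last by rewrite vl mul0r.
    rewrite (bigD1 (Ordinal ak)) //= mulr1 big1 ?addr0 => [|b nb]; last first.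
      by rewrite (_ : _ || _ = false) ?mulr0 //; move: nb; rewrite -val_eqE /=; lia.
    by apply; lia.
  rewrite big1 ?add0r => [|b _]; last by rewrite vl mul0r.
  rewrite (bigD1 (Ordinal ak)) //= eqxx mulr1 (bigD1 (Ordinal (ltnW ak))) /=; last first.
    by rewrite -val_eqE /=; lia.
  rewrite IH mul0r add0r big1 ?addr0 => [|b /andP[nb nb']]; last first.
    by rewrite (_ : _ || _ = false) ?mulr0 //; move: nb nb'; rewrite -!val_eqE /=; lia.
  by apply; lia.
rewrite -(hsubmxK v); apply/rowP => t; rewrite [RHS]mxE -(splitK t).
by case: (split t) => [a|[a ak]] /=; rewrite ?row_mxEl ?row_mxEr ?vl ?vr.
Qed.

(** Plays the part of 2 u_i u_j. The sign makes half of [path_square 0 0] send p_1 to p_0. *)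
Definition path_square i j : 'M[K]_(k + k) :=
  - ((path_vec i *m (path_vec j)^T + path_vec j *m (path_vec i)^T) *m Om).

Lemma path_square_sp i j : path_square i j \in symplectic K k.
Proof.
apply/symplecticP; rewrite /path_square; set M := _ + _.
have Ms : M^T = M by rewrite /M linearD /= !trmx_mul !trmxK addrC.
by rewrite (linearN (@trmx K _ _)) /= trmx_mul Ms Omega_tr mulNmx opprK mulmxN mulmxA !mulNmx.
Qed.

(** As Omega X = -X^T Omega, the bracket of X with M Omega is (X M + M X^T) Omega: X acts on
    symmetric tensors as a derivation. *)
Lemma sp_br_square (X : 'M[K]_(k + k)) i j : X \in symplectic K k ->
  [lie X, path_square i j] =
  - (((X *m path_vec i) *m (path_vec j)^T + path_vec j *m (X *m path_vec i)^T
   + ((X *m path_vec j) *m (path_vec i)^T + path_vec i *m (X *m path_vec j)^T)) *m Om).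
Proof.
move/symplecticP => hX; rewrite /lie_br /= /mx_br /path_square mulmxN mulNmx -opprD; congr (- _).
rewrite -(mulmxA _ Om X) hX mulmxN opprK !mulmxA -mulmxDl; congr (_ *m _).
rewrite mulmxDr mulmxDl !trmx_mul !mulmxA.
by rewrite (addrC (_ *m X^T)) addrACA.
Qed.

(** The coefficient is forced by [lie_square_diag]. *)
Definition path_gen i := ((-1) ^+ i / 2%:R) *: path_square i i.

Lemma path_gen_sp i : path_gen i \in symplectic K k.
Proof.
have [S0 SP] := lsub_submod (symplectic K k).
by rewrite -[path_gen i]addr0; apply: SP => //; apply: path_square_sp.
Qed.

Lemma path_genE i : path_gen i = (-1) ^+ i.+1 *: (path_vec i *m (path_vec i)^T *m Om).
Proof.
rewrite /path_gen /path_square -mulr2n -scaler_nat -scalemxAl -scalerN scalerA.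
by rewrite divfK ?pnatr_eq0 // exprS mulN1r scaleNr scalerN.
Qed.

Lemma path_gen_act i j : (i < k + k)%N -> (j < k + k)%N ->
  path_gen i *m path_vec j = path_vec i *+ adj i j.
Proof.
move=> ik jk; rewrite path_genE -scalemxAl -!mulmxA (mulmxA _ Om) path_form //.
rewrite mul_mx_scalar scalerA mulrnAr -expr2 sqrr_sign.
by case: (adj i j); rewrite ?scale1r ?scale0r.
Qed.

Lemma path_square_act l i j : (l < k + k)%N -> (i < k + k)%N -> (j < k + k)%N ->
  [lie path_gen l, path_square i j] =
    path_square l j *+ adj l i + path_square i l *+ adj l j.
Proof.
move=> lk ik jk; rewrite sp_br_square ?path_gen_sp // !path_gen_act // /path_square.
rewrite !mulNrn -opprD; congr (- _).
case: (adj l i); case: (adj l j); rewrite ?mulr0n ?trmx0 ?mul0mx ?mulmx0 ?addr0 ?add0r ?mul0mx //.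
  by rewrite mulmxDl; congr (_ + _ *m _); apply: addrC.
by rewrite addrC.
Qed.

(** Reduces both spanning and freeness to the invertibility of [path_mx] and Omega. *)
Lemma path_square_comb (A : 'M[K]_(k + k)) :
  square_comb path_square A = - (path_mx *m (A + A^T) *m path_mx^T *m Om).
Proof.
have half (B : 'M[K]_(k + k)) : path_mx *m B *m path_mx^T =
    \sum_(i < k + k) \sum_(j < k + k) B i j *: (path_vec i *m (path_vec j)^T).
  apply/matrixP => s t; rewrite mxE summxE.
  transitivity (\sum_(j < k + k) \sum_(i < k + k) path_vec i s 0 * B i j * path_vec j t 0).
    apply: eq_bigr => j _; rewrite mxE mulr_suml; apply: eq_bigr => i _.
    by rewrite [path_mx s i]mxE [path_mx^T j t]mxE [path_mx t j]mxE.
  rewrite exchange_big; apply: eq_bigr => i _; rewrite summxE; apply: eq_bigr => j _.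
  by rewrite [RHS]mxE [(path_vec i *m _) s t]mxE big_ord1 [(path_vec j)^T _ _]mxE mulrCA mulrA.
rewrite mulmxDr mulmxDl !half [X in _ + X]exchange_big -big_split /square_comb.
rewrite mulmx_suml -sumrN; apply: eq_bigr => i _.
rewrite -big_split mulmx_suml -sumrN; apply: eq_bigr => j _.
rewrite /= [A^T _ _]mxE.
by rewrite -scalerDr -scalemxAl scalerN.
Qed.

End PathBasis.

(** The action alone gives [e_i, [e_i, e_j]] = (-1)^j U_ii for adjacent i and j; they have opposite
    parity, so this is -2 e_i. *)
Lemma electrical_A_of_square (K : numFieldType) (L : lieAlgType K) n (U : nat -> nat -> L) :
  let e i := ((-1) ^+ i / 2%:R) *: U i i in
  square_family n (fun k => lie_ad (e k)) U -> electrical_A n e.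
Proof.
move=> e [Us Ua].
have br i j : (i < n)%N -> (j < n)%N ->
    [lie e i, e j] = (-1) ^+ j *: (U i j *+ adj i j).
  move=> iN jn; rewrite [e j]/e linearZ /= -[[lie _, _]]/(lie_ad (e i) _) Ua //.
  by rewrite (Us j i) -mulr2n -scaler_nat scalerA divfK ?pnatr_eq0.
split=> [i j ij|i j iN jn ij].
  have -> : [lie e i, e j] = (-1) ^+ j *: (U i j *+ adj i j) by apply: br; lia.
  by have -> : adj i j = false; rewrite ?mulr0n ?scaler0 // /adj; lia.
rewrite br // ij linearZ /= -[[lie _, _]]/(lie_ad (e i) _) Ua // ij.
rewrite (_ : adj i i = false); last by rewrite /adj; lia.
have s1 : (-1) ^+ j = - (-1) ^+ i :> K.
  by case/orP: ij => /eqP->; rewrite exprS mulN1r ?opprK.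
by rewrite add0r s1 /e scalerA mulrCA mulNr divff ?pnatr_eq0 // mulrN1.
Qed.

(** * Symplectic algebras as square models *)

Section Models.
Variables (K : numFieldType) (k : nat).
Local Notation Om := (Omega K k).

Lemma sub_square_model (S : lieSub 'M[K]_(k + k)) n : (n <= k + k)%N ->
  (forall i j, (i < n)%N -> (j < n)%N -> path_square K k i j \in lsub_pred S) ->
  (forall X, X \in lsub_pred S -> exists A : 'M[K]_n, X = square_comb (path_square K k) A) ->
  (forall A : 'M[K]_n, square_comb (path_square K k) A = 0 -> A + A^T = 0) ->
  square_model (sub_lie S) n.
Proof.
move=> nk inS span free.
(* For indices beyond n the matrix may lie outside S and U takes the default 0; symmetry of U still
   holds for all indices. *)
pose U i j : sub_lie S := insubd 0 (path_square K k i j).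
have valU i j : (i < n)%N -> (j < n)%N -> val (U i j) = path_square K k i j.
  by move=> iN jn; rewrite insubdK // inS.
pose e i := ((-1) ^+ i / 2%:R) *: U i i.
have vale i : (i < n)%N -> val (e i) = path_gen K k i.
  by move=> iN; rewrite GRing.valZ valU.
have hU : square_family n (fun k => lie_ad (e k)) U.
  split=> [i j|l i j ln iN jn]; first by rewrite /U /path_square addrC.
  have valMn (x : sub_lie S) (b : bool) : val (x *+ b) = val x *+ b.
    by case: b; rewrite ?GRing.val0.
  apply: val_inj; rewrite GRing.valD !valMn !valU //.
  transitivity ([lie val (e l), val (U i j)]); first by [].
  by rewrite vale // valU // path_square_act //; apply: leq_trans nk.
have comb (A : 'M[K]_n) : val (square_comb U A) = square_comb (path_square K k) A.
  rewrite /square_comb (big_morph _ (GRing.valD (U := sub_lie S)) (GRing.val0 _)).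
  apply: eq_bigr => i _; rewrite (big_morph _ (GRing.valD (U := sub_lie S)) (GRing.val0 _)).
  by apply: eq_bigr => j _; rewrite GRing.valZ valU.
exists e, U; split.
- exact: electrical_A_of_square.
- split=> //; rewrite /e expr0 mul1r -scaler_nat scalerA mulfV ?scale1r //.
  by rewrite pnatr_eq0.
- by move=> x; have [A hA] := span _ (valP x); exists A; apply: val_inj; rewrite comb.
- by move=> A hA; apply: free; rewrite -comb hA GRing.val0.
Qed.

(** X = -M Omega with M = X Omega symmetric, and M = P B P^T for a symmetric B; then A = B/2, so
    that A + A^T = B. The odd case uses the symmetry of A to pass from a zero row to a zero
    column. *)
Lemma symplectic_span X : X \in symplectic K k ->
  exists2 A : 'M[K]_(k + k), A^T = A & X = square_comb (path_square K k) A.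
Proof.
move/symplecticP => hX; pose M := X *m Om.
have XM : X = - (M *m Om) by rewrite -mulmxA Omega_sqr mulmxN mulmx1 opprK.
have XE : Om *m X^T *m Om = X.
  rewrite -mulmxA -[X^T *m Om]opprK -hX mulmxN mulmxA Omega_sqr.
  by rewrite mulNmx mul1mx opprK.
have Ms : M^T = M.
  rewrite trmx_mul Omega_tr mulNmx /M -[in RHS]XE -[RHS]mulmxA Omega_sqr.
  by rewrite mulmxN mulmx1.
clearbody M; pose P := path_mx K k; pose Q := invmx P.
pose B := Q *m M *m Q^T.
have Bs : B^T = B by rewrite !trmx_mul trmxK Ms mulmxA.
have PB : P *m B *m P^T = M.
  rewrite /B !mulmxA mulmxV ?path_mx_unit // mul1mx -mulmxA -trmx_mul.
  by rewrite mulmxV ?path_mx_unit // trmx1 mulmx1.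
exists (2%:R^-1 *: B); first by rewrite linearZ /= Bs.
rewrite path_square_comb linearZ /= Bs -mulr2n -scaler_nat scalerA mulfV ?pnatr_eq0 //.
by rewrite scale1r PB.
Qed.

Lemma symplectic_free (A : 'M[K]_(k + k)) :
  square_comb (path_square K k) A = 0 -> A + A^T = 0.
Proof.
rewrite path_square_comb => /(congr1 (fun X => X *m Om)).
rewrite mul0mx mulNmx -(mulmxA _ Om Om) Omega_sqr mulmxN opprK mulmx1 => h.
have PU := path_mx_unit K k; have PTU : (path_mx K k)^T \in unitmx by rewrite unitmx_tr.
by rewrite -[_ + _](mulKmx PU) -[_ *m (_ + _)](mulmxK PTU) h mul0mx mulmx0.
Qed.

Lemma symplectic_model : square_model (sub_lie (symplectic K k)) (k + k)%N.
Proof.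
apply: sub_square_model => // [i j _ _|X /symplectic_span[A _]|]; first exact: path_square_sp.
  by exists A.
exact: symplectic_free.
Qed.
End Models.

(** * The odd symplectic algebra *)

Section Border.
Variables (K : numFieldType) (M : lmodType K) (n : nat).
Implicit Types U : nat -> nat -> M.

Definition trunc_mx (A : 'M[K]_n.+1) : 'M[K]_n :=
  \matrix_(i, j) A (lift ord_max i) (lift ord_max j).

Definition extend_mx (A : 'M[K]_n) : 'M[K]_n.+1 :=
  \matrix_(i, j) if (unlift ord_max i, unlift ord_max j)
    is (Some i', Some j') then A i' j' else 0.

Lemma extend_mxK : cancel extend_mx trunc_mx.
Proof. by move=> A; apply/matrixP => i j; rewrite !mxE !liftK. Qed.

Lemma square_comb_trunc U (A : 'M[K]_n.+1) :
  (forall j, A ord_max j = 0) -> (forall i, A i ord_max = 0) ->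
  square_comb U A = square_comb U (trunc_mx A).
Proof.
have wl (i : 'I_n) : widen_ord (leqnSn n) i = lift ord_max i.
  by apply: val_inj; rewrite /= /bump leqNgt ltn_ord.
move=> A0 A1; rewrite /square_comb big_ord_recr /= [X in _ + X]big1 => [|j _]; last first.
  by rewrite A0 scale0r.
rewrite addr0; apply: eq_bigr => i _; rewrite big_ord_recr /= A1 scale0r addr0.
by apply: eq_bigr => j _; rewrite mxE !wl.
Qed.

Lemma square_comb_extend U (A : 'M[K]_n) :
  square_comb U (extend_mx A) = square_comb U A.
Proof.
rewrite square_comb_trunc ?extend_mxK // => i; rewrite mxE unlift_none //.
by case: unlift.
Qed.
End Border.

Section OddModel.
Variables (K : numFieldType) (k : nat).
Local Notation N := (k.+1 + k.+1)%N.
Local Notation n := (k + k.+1)%N.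
Local Notation V := (path_square K k.+1).
Local Notation y := (ylast k).

Lemma path_vec_last i : path_vec K k.+1 i y 0 = (i == n)%:R.
Proof. by rewrite /path_vec /ylast col_mxEu mxE /= -addnn addnS. Qed.

Lemma row_path_square i j : (i < n)%N -> (j < n)%N -> row y (V i j) = 0.
Proof.
move=> iN jn; rewrite rowE /path_square mulmxN mulmxA mulmxDr !mulmxA -!rowE.
have row0 l : (l < n)%N -> row y (path_vec K k.+1 l) = 0.
  by move=> ln; apply/rowP => t; rewrite ord1 mxE path_vec_last ltn_eqF // mxE.
by rewrite !row0 // !mul0mx addr0 mul0mx oppr0.
Qed.

Lemma row_path_mx : row y (path_mx K k.+1) = delta_mx 0 (ord_max : 'I_n.+1).
Proof.
apply/rowP => t; rewrite mxE [LHS]mxE path_vec_last !mxE eqxx /=.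
by congr (_%:R); rewrite -val_eqE.
Qed.

Lemma in_odd_symplectic X : (X \in lsub_pred (odd_symplectic K k)) =
  (X \in symplectic K k.+1) && (row y X == 0).
Proof. by []. Qed.

Lemma odd_symplectic_model : square_model (sub_lie (odd_symplectic K k)) n.
Proof.
apply: sub_square_model => [|i j iN jn|X|A hA].
- lia.
- by rewrite in_odd_symplectic path_square_sp row_path_square ?eqxx.
- rewrite in_odd_symplectic => /andP[/symplectic_span[A As hA] /eqP X0].
  have PTU : (path_mx K k.+1)^T \in unitmx by rewrite unitmx_tr path_mx_unit.
  (* Row y of [path_mx] is the last unit vector, so the vanishing of row y of X is that of the last
     row of A. The size [k.+1 + k.+1] is convertible to [n.+1]. *)
  have Arow : row (ord_max : 'I_n.+1) (A : 'M_n.+1) = 0.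
    move: X0; rewrite hA path_square_comb As rowE !mulmxN !mulmxA -rowE row_path_mx.
    move=> /(congr1 (fun X => X *m Omega K k.+1)).
    rewrite mul0mx mulNmx -(mulmxA _ (Omega K k.+1)) Omega_sqr mulmxN opprK mulmx1.
    move=> /(congr1 (fun X => X *m invmx (path_mx K k.+1)^T)); rewrite mul0mx mulmxK //.
    by rewrite mulmxDr -!rowE -mulr2n -[RHS](mul0rn _ 2) => /(@mulrn_inj _ _ 1).
  have A0 j : A (ord_max : 'I_n.+1) j = 0.
    by have /rowP/(_ j) := Arow; rewrite !mxE.
  exists (trunc_mx (A : 'M_n.+1)); rewrite hA; apply: square_comb_trunc => // i.
  by rewrite -As mxE.
(* Freeness is inherited by padding A with a zero row and column. *)
have := @symplectic_free K k.+1 (extend_mx A).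
rewrite (square_comb_extend _ A) => /(_ hA) /(congr1 (@trunc_mx K n)) h.
apply/matrixP => i j; have /matrixP/(_ i j) := h.
by rewrite !mxE !liftK.
Qed.
End OddModel.

(** * Assembling the isomorphisms *)

Lemma sp_model (K : numFieldType) m : square_model (sp K m) m.
Proof.
have mE := odd_double_half m; rewrite /sp; case: ifP mE => mo mE.
  have e : (m./2 + m./2.+1)%N = m by rewrite addnS addnn.
  by rewrite -[X in square_model _ X]e; apply: odd_symplectic_model.
have e : (m./2 + m./2)%N = m by rewrite addnn.
by rewrite -[X in square_model _ X]e; apply: symplectic_model.
Qed.

Lemma lie_isomorphic_trans (K : fieldType) (L1 L2 L3 : lieAlgType K) :
  lie_isomorphic L1 L2 -> lie_isomorphic L2 L3 -> lie_isomorphic L1 L3.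
Proof.
move=> [f [fM fB]] [g [gM gB]]; exists (g \o f).
by split=> [x y|]; [rewrite /= fM gM | apply: bij_comp].
Qed.

Lemma lie_isomorphic_pair (K : fieldType) (L1 L2 L1' L2' : lieAlgType K) :
  lie_isomorphic L1 L1' -> lie_isomorphic L2 L2' ->
  lie_isomorphic (L1 * L2)%type (L1' * L2')%type.
Proof.
move=> [f [fM [f' fK f'K]]] [g [gM [g' gK g'K]]].
pose h (x : L1 * L2) : L1' * L2' := (f x.1, g x.2).
have h_lin : linear h by move=> a x y; rewrite /h /= !linearP.
pose hM := GRing.isLinear.Build K (L1 * L2)%type (L1' * L2')%type *:%R h h_lin.
pose phi : {linear (L1 * L2)%type -> (L1' * L2')%type} := HB.pack h hM.
exists phi; split=> [x y|]; first by rewrite /phi /= /h !pair_br fM gM.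
exists (fun x => (f' x.1, g' x.2)) => -[a b]; rewrite /phi /= /h /=.
  by rewrite fK gK.
by rewrite f'K g'K.
Qed.

Theorem theorem2p8 (R : realType) (n : nat) (hn : (2 <= n)%N) :
  (exists phi : {linear eB R[i] n ->
       (eA_nodes R[i] 1 n * eA_nodes R[i] 2 n)%type},
     [/\ lie_isomorphism phi,
         forall h1 : (1 <= 1 <= n)%N,
           phi (eB_gen R[i] h1) = (eA_gen R[i] h1, 0)
       & forall (k : nat) (hk : (1 <= k <= n)%N) (hk' : (2 <= k <= n)%N),
           phi (eB_gen R[i] hk) = (eA_gen R[i] hk, eA_gen R[i] hk')]) /\
  lie_isomorphic (eB R[i] n) (sp R[i] n * sp R[i] n.-1)%type.
Proof.
(* The sizes are the numbers of nodes in 1..n and in 2..n, namely n and n-1. *)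
have m1 : square_model (sp R[i] n) (n.+1 - 1)%N by rewrite subn1; apply: sp_model.
have m2 : square_model (sp R[i] n.-1) (n.+1 - 2)%N by rewrite subn2; apply: sp_model.
have [phi [phi_iso phi_gen]] := eB_to_eA_iso (ltnW hn) m1.
have phi_node k (hk : (1 <= k <= n)%N) : phi (eB_gen R[i] hk) = eB_image R[i] n k.-1.
  rewrite -phi_gen; last by case: k hk => // k; lia.
  by rewrite /eB_seq (node_seqE _ (i := exist _ k hk)) //=; case: k hk.
split; last first.
  by apply: lie_isomorphic_trans (lie_isomorphic_pair (eA_iso m1) (eA_iso m2)); exists phi.
exists phi; split=> // [h1|k hk hk']; rewrite phi_node /eB_image /eA_seq.
  by rewrite (node_seqE _ (i := exist _ 1%N h1)).
case: k hk hk' => [|[|k]] hk hk' //.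
by rewrite /= (node_seqE _ (i := exist _ k.+2 hk)) // (node_seqE _ (i := exist _ k.+2 hk')).
Qed.
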